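(* Let $\beta$ be a Pisot number and let $T:[0,1]\to[0,1]$, $T(x)=\{\beta x\}$ (fractional part), equipped with its unique absolutely continuous invariant probability measure $\mu_\beta$. Let $[0,1]=\bigcup_{i=1}^{\ell} J_i$ be a finite partition of $[0,1]$ into subintervals, and let $S:[0,1]\to[0,1]$ be given by $$S(x)=\epsilon_i \beta^{m_i} x + b_i \quad\text{for } x\in J_i,$$ where $\epsilon_i\in\{-1,1\}$, $m_i$ is a positive integer and $b_i\in\mathbb{Q}(\beta)$ for $1\le i\le\ell$. Suppose that $S$ preserves a probability measure $\nu$ which is ergodic and absolutely continuous with respect to Lebesgue measure $\lambda$, and that there exists a constant $c>0$ with $$c^{-1}\lambda(E)\le \nu(E)\le c\,\lambda(E)$$ for every Borel set $E\subset[0,1]$. Then $T$ and $S$ are generic point equivalent, i.e., a point $x\in[0,1]$ is $T$-generic (with respect to $\mu_\beta$) if and only if it is $S$-generic (with respect to $\nu$).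
   Context: A Pisot number is a real algebraic integer greater than one all of whose Galois conjugates other than itself have modulus less than one (every integer greater than $1$ is one). The map $x\mapsto\{\beta x\}$ is ergodic with respect to a unique probability measure $\mu_\beta$ absolutely continuous with respect to Lebesgue measure (Parry's measure). The subintervals $J_i$ may be closed, open, half-open, or singletons. For a map $R:[0,1]\to[0,1]$ preserving a probability measure $\rho$, a point $x$ is called $R$-generic if $\lim_{N\to\infty}\frac1N\sum_{n=0}^{N-1} f(R^n x)=\int f\,d\rho$ for every continuous function $f$ on $[0,1]$. *)

(* Defs.v *)
From HB Require Import structures.
From mathcomp Require Import all_boot all_order all_algebra.
From mathcomp Require Import all_classical all_reals all_analysis.
From mathcomp Require Import complex.
Set Implicit Arguments. Unset Strict Implicit. Unset Printing Implicit Defensive.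
Import Order.TTheory GRing.Theory Num.Theory numFieldNormedType.Exports.
Local Open Scope classical_set_scope.
Local Open Scope ring_scope.

Definition pisot {R : realType} (b : R) : Prop :=
  1 < b /\
  exists p : {poly int},
    [/\ p \is monic,
        irreducible_poly (map_poly (intr : int -> rat) p),
        root (map_poly (intr : int -> R) p) b &
        forall z : R[i], root (map_poly (intr : int -> R[i]) p) z ->
          z != (b%:C)%C -> `|z| < 1].

(* x belongs to the field Q(beta) (= Q[beta] since beta is algebraic) *)
Definition in_Qbeta {R : realType} (b x : R) : Prop :=
  exists q : {poly rat}, x = (map_poly (ratr : rat -> R) q).[b].

Definition beta_map {R : realType} (b : R) (x : R) : R :=
  b * x - (Num.floor (b * x))%:~R.

Definition unit_itv {R : realType} : set (measurableTypeR R) := `[0%R, 1%R].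

Definition prob_on_unit {R : realType}
  (rho : {measure set (measurableTypeR R) -> \bar R}) : Prop :=
  rho unit_itv = 1%E /\ rho (~` unit_itv) = 0%E.

Definition abs_cont_leb {R : realType}
  (rho : {measure set (measurableTypeR R) -> \bar R}) : Prop :=
  forall E : set (measurableTypeR R), measurable E ->
    lebesgue_measure E = 0%E -> rho E = 0%E.

Definition preserves {R : realType} (f : R -> R)
  (rho : {measure set (measurableTypeR R) -> \bar R}) : Prop :=
  forall E : set (measurableTypeR R), measurable E -> E `<=` unit_itv ->
    rho (unit_itv `&` f @^-1` E) = rho E.

Definition ergodic {R : realType} (f : R -> R)
  (rho : {measure set (measurableTypeR R) -> \bar R}) : Prop :=
  forall E : set (measurableTypeR R), measurable E -> E `<=` unit_itv ->
    unit_itv `&` f @^-1` E = E -> rho E = 0%E \/ rho E = 1%E.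

Definition generic {R : realType} (f : R -> R)
  (rho : {measure set (measurableTypeR R) -> \bar R}) (x : R) : Prop :=
  forall g : R -> R, {within `[0%R, 1%R], continuous g} ->
    (fun N : nat => N%:R^-1 * \sum_(0 <= n < N) g (iter n f x)) @ \oo -->
      fine (\int[rho]_(y in unit_itv) (g y)%:E).

(* Main.v *)
Require Import Defs.
From HB Require Import structures.
From mathcomp Require Import all_boot all_order all_algebra.
From mathcomp Require Import all_classical all_reals all_analysis.
From mathcomp Require Import measurable_realfun separable complex ring lra zify.
Import Order.TTheory GRing.Theory Num.Theory numFieldNormedType.Exports.
Local Open Scope classical_set_scope.
Local Open Scope ring_scope.

(**
Along an orbit, S^k x = s_k T^(M_k) x + phi_k where s_k is a sign, M_k
increases with bounded gaps, and (after clearing denominators) phi_k is an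
element of Z[beta] that is bounded together with all its conjugates, because
the conjugates of beta contract.  Hence phi_k ranges over a finite set.
Therefore, for nonnegative g, the Birkhoff sums of g along either orbit are
dominated by sums along the other orbit of finitely many compositions of g
with piecewise affine maps.

Let x be generic for one of the maps.  For continuous phi let g_K be the
absolute deviation of the K-step ergodic average of phi, for the other map,
from its integral.  By Birkhoff's theorem g_K tends to 0 Lebesgue-almost
everywhere, hence almost everywhere for both absolutely continuous invariant
measures.  The averages of g_K along the orbit of x are bounded above by
integrals that tend to 0, so x is generic for the other map as well.

Birkhoff's theorem needs ergodicity of T with respect to Lebesgue measure.
The maximal intervals on which T^n is affine are mapped onto intervals
[0, t) with t in a finite set (again by the Pisot property), so by Lebesgue's
density theorem an invariant set of positive measure contains almost all of
[0, d) for a fixed d > 0; this cannot hold for a set and its complement.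
*)

Set Implicit Arguments.
Unset Strict Implicit.

(** * Finiteness from the Pisot property *)

(** In characteristic zero the derivative of an irreducible rational polynomial is nonzero and of
    smaller degree, hence coprime to it, and coprimality survives extension to [R[i]]. Distinct
    roots are what makes the Vandermonde matrix below invertible. *)
Lemma int_irreducible_separable (R : realType) (p : {poly int}) :
  irreducible_poly (map_poly (intr : int -> rat) p) ->
  separable_poly (map_poly (intr : int -> R[i]) p).
Proof.
move=> irr; set P := map_poly _ p in irr.
have -> : map_poly (intr : int -> R[i]) p = map_poly (ratr : rat -> R[i]) P.
  by rewrite -map_poly_comp; apply: eq_map_poly => z /=; rewrite ratr_int.
rewrite separable_map unlock.
have [sP irrP] := irr; rewrite irreducible_poly_coprime //; apply/negP.
have P0 : P != 0 by rewrite -size_poly_gt0 ltnW.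
have dP0 : P^`() != 0.
  apply: contraTneq (P0) => /polyP/(_ (size P).-2); rewrite coef0 coef_deriv.
  rewrite prednK ?(ltn_predRL 0) // => /eqP; rewrite mulrn_eq0.
  rewrite -lead_coefE lead_coef_eq0; case/orP => [|->//].
  by move: sP; case: (size P) => [|[]].
by move=> /dvdp_leq => /(_ dP0); rewrite leqNgt lt_size_deriv.
Qed.

Lemma int_poly_mod (K : comNzRingType) (p q : {poly int}) (z : K) : p \is monic ->
  root (map_poly intr p) z ->
  (map_poly intr q).[z] = (map_poly intr (Pdiv.Ring.rmodp q p)).[z] :> K.
Proof.
move=> mp /rootP pz.
rewrite [in LHS](Pdiv.RingMonic.rdivp_eq mp q) rmorphD rmorphM /= hornerD hornerM.
by rewrite pz mulr0 add0r.
Qed.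

(* An integer polynomial modulo [p] is determined by its values at the roots
   of [p] through an inverse Vandermonde matrix, which bounds its coefficients. *)
Lemma pisot_finite (R : realType) (b A : R) (p : {poly int}) (B : R[i] -> R[i]) :
  p \is monic -> irreducible_poly (map_poly (intr : int -> rat) p) ->
  root (map_poly intr p) b ->
  exists s : seq R, forall q : {poly int},
    `|(map_poly intr q).[b]| <= A ->
    (forall z : R[i], root (map_poly intr p) z -> z != (b%:C)%C ->
      `|(map_poly intr q).[z]| <= B z) ->
    (map_poly intr q).[b] \in s.
Proof.
move=> mp irr rb.
have sep := int_irreducible_separable R irr.
set P := map_poly _ p in sep.
have [rs Prs] := closed_field_poly_normal P.
have mP : P \is monic by rewrite monic_map.
move: Prs; rewrite (monicP mP) scale1r => Prs.
have urs : uniq rs by rewrite -separable_prod_XsubC -Prs.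
have rrs z : (z \in rs) = root P z by rewrite Prs root_prod_XsubC.
set d := size rs.
have sp : size p = d.+1.
  have -> : size p = size P.
    by rewrite size_map_poly_id0 // (monicP mp); exact: oner_neq0.
  by rewrite Prs size_prod_XsubC.
pose B' z := if z == (b%:C)%C then (A%:C)%C else B z.
pose rt := \row_(j < d) rs`_j.
pose V := Vandermonde d rt.
have Vu : V \in unitmx.
  rewrite unitmxE det_Vandermonde unitfE; apply/prodf_neq0 => i _.
  apply/prodf_neq0 => j ij; rewrite !mxE subr_eq0 nth_uniq //.
  by rewrite neq_ltn ij orbT.
(* The coefficients of the remainder are its values at the roots times [invmx V]; summing over all
   entries gives one bound valid for every coefficient. *)
pose Kc := (\sum_(i < d) \sum_(j < d) `|B' rs`_j| * `|invmx V j i|).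
pose N := Num.truncn (complex.Re Kc).
(* Coefficients in [[-N, N]] are coded by ordinals below [2N + 1] through a shift by [N]. *)
pose g (f : {ffun 'I_d -> 'I_(N.*2.+1)}) : R :=
  \sum_(i < d) (((f i : nat)%:Z - N%:Z)%:~R) * b ^+ i.
exists [seq g f | f : {ffun 'I_d -> 'I_(N.*2.+1)}] => q qb qz.
have rbC : root P (b%:C)%C.
  have -> : P = map_poly (real_complex R) (map_poly intr p).
    by rewrite -map_poly_comp; apply: eq_map_poly => z /=; rewrite rmorph_int.
  by rewrite rmorph_root.
pose u := Pdiv.Ring.rmodp q p.
have su : (size u <= d)%N.
  by rewrite -ltnS -sp Pdiv.Ring.ltn_rmodpN0 // monic_neq0.
have uz z : root P z -> `|(map_poly intr u).[z]| <= B' z.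
  move=> rz; rewrite -(int_poly_mod _ mp rz) /B'; case: eqP => [->|/eqP zb].
    have -> : (map_poly intr q).[(b%:C)%C] = (((map_poly intr q).[b])%:C)%C.
      rewrite -horner_map -map_poly_comp; congr (_.[_]).
      by apply: eq_map_poly => t /=; rewrite rmorph_int.
    by rewrite normc_def /= expr0n addr0 sqrtr_sqr lecR.
  exact: qz.
pose uv : 'rV[R[i]]_d := \row_i (u`_i)%:~R.
have uvV : uv *m V = \row_j (map_poly intr u).[rs`_j].
  apply/rowP => j; rewrite !mxE.
  rewrite (@horner_coef_wide _ d); last by rewrite (leq_trans (size_poly _ _)).
  by apply: eq_bigr => i _; rewrite !mxE coef_map.
have ub i : (i < d)%N -> `|(u`_i)%:~R : R[i]| <= Kc.
  move=> it.
  have : uv = (uv *m V) *m invmx V by rewrite mulmxK.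
  rewrite uvV => /rowP/(_ (Ordinal it)); rewrite !mxE /= => ->.
  apply: (le_trans (ler_norm_sum _ _ _)).
  rewrite /Kc [leRHS](bigD1 (Ordinal it)) //= -[leLHS]addr0; apply: lerD; last first.
    by do 2!apply: sumr_ge0 => ? _; rewrite mulr_ge0.
  apply: ler_sum => j _; rewrite mxE normrM ler_wpM2r //.
  have := uz rs`_j; rewrite -rrs mem_nth // => /(_ isT) h.
  by rewrite (ger0_norm (le_trans _ h)).
have KcR : Kc = ((complex.Re Kc)%:C)%C.
  apply/eqP; rewrite eq_complex eqxx /=.
  have : (0 : R[i]) <= Kc.
    by do 2!apply: sumr_ge0 => ? _; rewrite mulr_ge0.
  by rewrite lecE /= => /andP[].
have ubN i : (i < d)%N -> `|u`_i| <= N%:Z.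
  move=> id; have := ub i id; rewrite KcR -intr_norm.
  rewrite -(rmorph_int (real_complex R)) lecR.
  have := abszE u`_i => /= <-; rewrite -pmulrn => /le_truncn; rewrite natrK.
  by rewrite lez_nat.
pose f := [ffun i : 'I_d => inord (absz (u`_i + N%:Z)) : 'I_(N.*2.+1)].
apply/mapP; exists f; first by rewrite mem_enum.
rewrite (int_poly_mod _ mp rb) -/u (@horner_coef_wide _ d); last first.
  by rewrite (leq_trans (size_poly _ _)).
apply: eq_bigr => i _; rewrite coef_map /= ffunE; congr (_%:~R * _).
have := ubN i (ltn_ord i); rewrite ler_norml => /andP[h1 h2].
have h3 : 0 <= (u`_i : int) + N%:Z by rewrite addrC -lerBlDl sub0r.
rewrite inordK; first by rewrite gez0_abs // addrK.
by move: h2 h3; move: (u`_i : int) => v h2 h3; lia.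
Qed.

(** * The pointwise ergodic theorem *)

Section bounded_integrals.
Context {R : realType} (rho : {measure set (measurableTypeR R) -> \bar R}).
Hypothesis rho1 : rho setT = 1%E.

Definition bounded_measurable (g : R -> R) :=
  measurable_fun [set: measurableTypeR R] g /\ exists M, forall x, `|g x| <= M.

Lemma bounded_measurable_integrable g : bounded_measurable g ->
  rho.-integrable setT (EFin \o g).
Proof.
move=> [mg [M gM]]; apply: measurable_bounded_integrable => //.
  by rewrite rho1 ltry.
exists M; split; first exact: num_real.
by move=> N MN x _; exact: le_trans (gM x) (ltW MN).
Qed.

Lemma Rintegral_cst1 (r : R) : \int[rho]_x r = r.
Proof. by rewrite Rintegral_cst // rho1 mulr1. Qed.

Lemma bounded_convergence (u : nat -> R -> R) (g : R -> R) (M : R) :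
  (forall n, measurable_fun [set: measurableTypeR R] (u n)) ->
  measurable_fun [set: measurableTypeR R] g ->
  (forall n x, `|u n x| <= M) ->
  {ae rho, forall x, u ^~ x @ \oo --> g x} ->
  (fun n => \int[rho]_x u n x) @ \oo --> \int[rho]_x g x.
Proof.
move=> mu mg uM ug; apply: fine_cvg.
have mM : bounded_measurable (cst M).
  by split; [exact: measurable_cst | exists `|M|].
have [|||||ig _ h] := @dominated_convergence _ _ R rho setT measurableT
  (fun n => EFin \o u n) (EFin \o g) (EFin \o cst M).
- by move=> n; apply/measurable_EFinP.
- exact/measurable_EFinP.
- have := ae_filter_ringOfSetsType rho => F.
  by apply: filterS ug => x ux _; apply: cvg_EFin => //; exact: nearW.
- exact: bounded_measurable_integrable mM.
- by apply: aeW => x n _; rewrite /= lee_fin.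
rewrite fineK; first exact: h.
exact: (integrable_fin_num measurableT ig).
Qed.

Lemma Rintegral_comp (f g : R -> R) :
  measurable_fun [set: measurableTypeR R] (f : R -> measurableTypeR R) ->
  (forall E : set (measurableTypeR R), measurable E -> rho (f @^-1` E) = rho E) ->
  bounded_measurable g ->
  \int[rho]_x g (f x) = \int[rho]_x g x.
Proof.
move=> mf inv bg; pose pm : {measure set (measurableTypeR R) -> \bar R} :=
  pushforward rho (f : measurableTypeR R -> measurableTypeR R).
rewrite /Rintegral; congr fine.
rewrite [RHS](eq_measure_integral (pm mf)); last first.
  by move=> A mA _; rewrite /pm /= /pushforward inv.
have bgf : bounded_measurable (g \o f).
  split; first by apply: measurableT_comp => //; exact: bg.1.
  by have [_ [M gM]] := bg; exists M => x /=.
have igf := bounded_measurable_integrable bgf.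
have mg : measurable_fun [set: measurableTypeR R] (EFin \o g).
  by apply/measurable_EFinP; exact: bg.1.
by rewrite (integral_pushforward mf mg igf measurableT).
Qed.

End bounded_integrals.

(** The maximum of 0 and the first [n] Birkhoff sums of [h], in the recursive form used by the
    maximal ergodic argument. *)
Fixpoint running_max {R : realType} (f h : R -> R) n y : R :=
  if n is n'.+1 then Num.max 0 (h y + running_max f h n' (f y)) else 0.

Section running_max.
Context {R : realType} (f h : R -> R).
Local Notation Mx := (running_max f h).

Lemma running_max_ge0 n y : 0 <= Mx n y.
Proof. by case: n => //= n; rewrite le_max lexx. Qed.

Lemma running_max_le n y : Mx n y <= Mx n.+1 y.
Proof.
elim: n y => [|n IH] y; first exact: running_max_ge0.
by rewrite [leLHS]/= [leRHS]/= ge_max le_max lexx /= le_max lerD2l IH orbT.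
Qed.

Lemma sum_le_running_max n y : \sum_(i < n) h (iter i f y) <= Mx n y.
Proof.
elim: n y => [|n IH] y; first by rewrite big_ord0.
rewrite big_ord_recl /= le_max lerD2l; apply/orP; right.
apply: le_trans (IH (f y)); apply: ler_sum => i _.
by rewrite /bump /= -iterSr.
Qed.

Lemma bounded_measurable_running_max n :
  measurable_fun [set: measurableTypeR R] (f : R -> measurableTypeR R) ->
  bounded_measurable h -> bounded_measurable (Mx n).
Proof.
move=> mf [mh [B hB]]; elim: n => [|n [mM [M MM]]].
  by split; [exact: measurable_cst | exists 0 => x; rewrite normr0].
split.
  apply: measurable_maxr => //; apply: measurable_funD => //.
  exact: measurableT_comp.
exists (B + M) => x; rewrite ger0_norm ?running_max_ge0 //= ge_max.
have B0 := le_trans (normr_ge0 _) (hB x).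
have M0 := le_trans (normr_ge0 _) (MM x).
rewrite addr_ge0 //= lerD // ?(le_trans (ler_norm _) (hB _)) //.
by rewrite (le_trans (ler_norm _) (MM _)).
Qed.

End running_max.

Lemma abs_cont_ae {R : realType} (rho : {measure set (measurableTypeR R) -> \bar R})
  (P : R -> Prop) : abs_cont_leb rho ->
  {ae lebesgue_measure, forall x, P x} -> {ae rho, forall x, P x}.
Proof. by move=> ac [N [mN N0 sN]]; exists N; split => //; exact: ac. Qed.

Section pointwise_ergodic.
Context {R : realType} (rho : {measure set (measurableTypeR R) -> \bar R}).
Variable f : R -> R.
Hypothesis rho1 : rho setT = 1%E.
Hypothesis mf : measurable_fun [set: measurableTypeR R] (f : R -> measurableTypeR R).
Hypothesis f01 : forall x, unit_itv (f x) <-> unit_itv x.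
Hypothesis inv :
  forall E : set (measurableTypeR R), measurable E -> rho (f @^-1` E) = rho E.
Hypothesis triv : forall E : set (measurableTypeR R), measurable E ->
  E `<=` unit_itv -> f @^-1` E = E ->
  lebesgue_measure E = 0%E \/ rho (~` E) = 0%E.

(** The set [E] where the running maxima are unbounded is invariant, so by [triv] it is
    Lebesgue-null or has full [rho] measure. In the second case the differences [D n] have
    nonnegative integrals, by invariance and monotonicity, and converge to [h] on [E], which
    contradicts the negative integral of [h]. The Lebesgue alternative in [triv] is what makes the
    conclusion hold Lebesgue-almost everywhere. *)
Lemma running_max_bounded_ae h : bounded_measurable h -> \int[rho]_x h x < 0 ->
  {ae lebesgue_measure, forall y, unit_itv y ->
     exists m : nat, forall n, running_max f h n y <= m%:R}.
Proof.
move=> bh; have [mh [B hB]] := bh.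
have bM n := bounded_measurable_running_max n mf bh.
pose E : set (measurableTypeR R) :=
  unit_itv `&` \bigcap_(m in @setT nat) \bigcup_(n in @setT nat)
    [set y | m%:R < running_max f h n y].
have mE : measurable E.
  apply: measurableI; first exact: measurable_itv.
  apply: bigcap_measurableType => m _; apply: bigcup_measurable => n _.
  rewrite (_ : [set _ | _] = setT `&` (running_max f h n) @^-1` `]m%:R, +oo[%classic).
    by apply: (bM n).1 => //; exact: measurable_itv.
  by apply/seteqP; split => y /=; rewrite in_itv /= andbT // => -[].
(* As [|h| <= B], passing between [y] and [f y] costs at most [B] in the level and one in the
   index. *)
have Einv : f @^-1` E = E.
  apply/seteqP; split => y [/f01 y01 yE]; split => // m _.
  - have [n _ /= hn] := yE (Num.truncn (m%:R + B)).+1 I.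
    exists n.+1 => //=; rewrite lt_max; apply/orP; right.
    have := lt_trans (truncnS_gt _) hn; rewrite -ltrBrDr => /lt_le_trans; apply.
    rewrite addrC lerD2r.
    by have := hB y; rewrite ler_norml => /andP[].
  - have [[|n] _ /= hn] := yE (Num.truncn (m%:R + B)).+1 I.
      by move: hn; rewrite ltNge ler0n.
    exists n => //=; move: hn; rewrite lt_max ltNge ler0n /= => hn.
    have h1 := lt_trans (truncnS_gt _) hn.
    have h2 := le_trans (ler_norm _) (hB y).
    by rewrite /=; lra.
case: (triv mE _ Einv) => [x []//|E0 _|E0].
  exists E; split => // y /= ny; split.
    by apply: contrapT => y01; apply: ny.
  move=> m _; apply: contrapT => nm; apply: ny => _; exists m => n.
  by rewrite leNgt; apply/negP => mn; apply: nm; exists n.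
suff : 0 <= \int[rho]_x h x by rewrite ltNge => ->.
pose D n y := running_max f h n.+1 y - running_max f h n (f y).
have bMf n : bounded_measurable (fun y => running_max f h n (f y)).
  split; first by apply: measurableT_comp => //; exact: (bM n).1.
  by have [_ [M MM]] := bM n; exists M.
have De n y : D n y = Num.max (- running_max f h n (f y)) (h y).
  by rewrite /D /= addr_maxl sub0r addrK.
have D0 n : 0 <= \int[rho]_x D n x.
  rewrite RintegralB ?subr_ge0 //; try exact: bounded_measurable_integrable.
  rewrite (Rintegral_comp rho1 mf inv) //.
  apply: le_Rintegral => //; try exact: bounded_measurable_integrable.
  by move=> x _; exact: running_max_le.
suff : (fun n => \int[rho]_x D n x) @ \oo --> \int[rho]_x h x.
  move=> cv; rewrite -(cvg_lim _ cv) //; apply: limr_ge; last exact: nearW.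
  by apply/cvg_ex; eexists; exact: cv.
apply: (@bounded_convergence _ _ rho1 _ _ B) => //.
- by move=> n; apply: measurable_funB; [exact: (bM n.+1).1 | exact: (bMf n).1].
(* When the maximum is not [h x], it is the nonpositive number [- running_max f h n (f x)], which
   lies above [h x]. *)
- move=> n x; rewrite De maxElt; case: ifPn => // hn.
  rewrite -leNgt in hn; rewrite normrN ger0_norm ?running_max_ge0 //.
  apply: le_trans (hB x); rewrite -normrN; apply: le_trans (ler_norm _).
  by rewrite lerNr.
exists (~` E); split => //; first exact: measurableC.
move=> y /= ny yE; apply: ny.
have : E (f y) by move: yE; rewrite -{1}Einv.
move=> [_ /(_ (Num.truncn B).+1 I)[n0 _ /= hn0]].
apply: cvg_near_cst; exists n0 => // n /= n0n.
rewrite De; apply/max_idPr; rewrite lerNl.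
have mono : running_max f h n0 (f y) <= running_max f h n (f y).
  by apply: (@homo_leq _ (fun k => running_max f h k (f y)) <=%R) n0n;
    [exact: lexx | exact: le_trans | move=> k; exact: running_max_le].
apply: le_trans mono; apply: le_trans (ltW hn0).
apply: le_trans (ltW (truncnS_gt B)).
by apply: le_trans (hB y); rewrite -normrN ler_norm.
Qed.

(** The function [g - a] has negative integral, so its running maxima, which dominate its Birkhoff
    sums, are almost everywhere bounded. *)
Lemma birkhoff_sum_upper g a : bounded_measurable g -> \int[rho]_x g x < a ->
  {ae lebesgue_measure, forall y, unit_itv y ->
     exists m : nat, forall n, \sum_(i < n) g (iter i f y) <= n%:R * a + m%:R}.
Proof.
move=> [mg [B gB]] ga.
have bh : bounded_measurable (fun y => g y - a).
  split; first by apply: measurable_funB => //; exact: measurable_cst.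
  by exists (B + `|a|) => x; rewrite (le_trans (ler_normB _ _)) // lerD2r.
have ih : \int[rho]_x (g x - a) < 0.
  rewrite RintegralB //; last 2 first.
  - exact: bounded_measurable_integrable (conj mg (ex_intro _ B gB)).
  - apply: bounded_measurable_integrable => //.
    by split; [exact: measurable_cst | exists `|a|].
  by rewrite Rintegral_cst1 // subr_lt0.
have F := ae_filter_ringOfSetsType (@lebesgue_measure R).
apply: filterS (running_max_bounded_ae bh ih) => y + y01 => /(_ y01)[m hm].
exists m => n; rewrite -lerBlDl; apply: le_trans (hm n).
apply: le_trans (sum_le_running_max f _ n y).
by rewrite sumrB sumr_const card_ord mulr_natl.
Qed.

(** The upper bound is applied to [g] and to [- g], with the countably many slacks [1/(k+1)] treated
    simultaneously. *)
Theorem birkhoff g : bounded_measurable g ->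
  {ae lebesgue_measure, forall y, unit_itv y ->
    (fun N : nat => N%:R^-1 * \sum_(0 <= n < N) g (iter n f y)) @ \oo -->
      \int[rho]_x g x}.
Proof.
move=> bg; set I := \int[rho]_x g x.
have bNg : bounded_measurable (fun y => - g y).
  have [mg [B gB]] := bg; split; first exact: measurableT_comp.
  by exists B => x; rewrite normrN.
have INg : \int[rho]_x (- g x) = - I.
  rewrite -[RHS]mulN1r -RintegralZl //; last exact: bounded_measurable_integrable.
  by apply: eq_Rintegral => x _; rewrite mulN1r.
have F := ae_filter_ringOfSetsType (@lebesgue_measure R).
have up : {ae lebesgue_measure, forall y, forall k : nat, unit_itv y ->
     exists m : nat, forall n, \sum_(i < n) g (iter i f y) <= n%:R * (I + k.+1%:R^-1) + m%:R}.
  apply: ae_foralln => k; apply: (@birkhoff_sum_upper g (I + k.+1%:R^-1)) => //.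
  by rewrite ltrDl invr_gt0.
have dn : {ae lebesgue_measure, forall y, forall k : nat, unit_itv y ->
     exists m : nat, forall n, \sum_(i < n) (- g (iter i f y)) <= n%:R * (- I + k.+1%:R^-1) + m%:R}.
  apply: ae_foralln => k.
  apply: (@birkhoff_sum_upper (fun y => - g y) (- I + k.+1%:R^-1)) => //.
  by rewrite INg ltrDl invr_gt0.
apply: filterS2 up dn => y up dn y01.
apply/cvgrPdist_le => e e0.
have e20 : 0 < e / 2 by rewrite divr_gt0.
pose k := Num.truncn (e / 2)^-1.
have ke : k.+1%:R^-1 <= e / 2.
  by rewrite invf_ple ?posrE // ltW // truncnS_gt.
have [m1 h1] := up k y01; have [m2 h2] := dn k y01.
(* From this index on, the additive constants [m1] and [m2] are at most [n * (e / 2)]; the slack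
   [1/(k+1)] takes the other half of [e]. *)
exists (Num.truncn ((m1 + m2)%:R / (e / 2))).+1 => // n /= kn.
have n0 : 0 < n%:R :> R by rewrite ltr0n (leq_trans _ kn).
have mn : (m1 + m2)%:R <= n%:R * (e / 2).
  rewrite -ler_pdivrMr //; apply: le_trans (ltW (truncnS_gt _)) _.
  by rewrite ler_nat.
have := h1 n; have := h2 n; rewrite sumrN.
rewrite big_mkord; set s := \sum_(i < n) _ => g2 g1.
have -> : I - n%:R^-1 * s = n%:R^-1 * (n%:R * I - s).
  by rewrite mulrBr mulKf // gt_eqF.
rewrite normrM gtr0_norm ?invr_gt0 // ler_pdivrMl // ler_norml.
have ke' : n%:R * k.+1%:R^-1 <= n%:R * (e / 2) by rewrite ler_wpM2l // ltW.
move: g1 g2 mn ke'; rewrite !mulrDr natrD; have := ler0n R m1; have := ler0n R m2.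
move: (n%:R * k.+1%:R^-1) => w p2 p1 g1 g2 mn ke'.
by apply/andP; split; lra.
Qed.

End pointwise_ergodic.

(** * Functions continuous off a countable set *)

(** A stable class containing the averages along piecewise affine maps; the exceptional set is null
    for every absolutely continuous measure. *)
Definition continuous_off_countable {R : realType} (g : R -> R) :=
  exists2 Z : set R, countable Z & forall y, ~ Z y -> {for y, continuous g}.

Section continuous_off_countable.
Context {R : realType}.
Implicit Types (g a : R -> R) (Z : set R).

Lemma subset_countable (T : Type) (A B : set T) :
  A `<=` B -> countable B -> countable A.
Proof. by move=> AB; apply: sub_countable; exact: subset_card_le. Qed.

Lemma image_countable (T U : Type) (h : T -> U) (A : set T) :
  countable A -> countable (h @` A).
Proof. by apply: sub_countable; exact: card_image_le. Qed.

Lemma setU_countable (T : Type) (A B : set T) :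
  countable A -> countable B -> countable (A `|` B).
Proof.
by move=> cA cB; rewrite -bigcup2E; apply: bigcup_countable => // -[|[|n]].
Qed.

Lemma countable_measurableR Z : countable Z -> measurable (Z : set (measurableTypeR R)).
Proof. by apply: countable_measurable => t; exact: measurable_set1. Qed.

(** The preimage of an open interval is its interior together with some points of the countable
    exceptional set. *)
Lemma continuous_off_countable_measurable g : continuous_off_countable g ->
  measurable_fun [set: measurableTypeR R] (g : R -> measurableTypeR R).
Proof.
move=> [Z cZ cg]; apply: (measurability _ (RGenOpens.measurableE R)) => //=.
move=> _ [_ [x [y ->]] <-]; set U := `]x, y[%classic; rewrite setTI.
rewrite (_ : g @^-1` U = (g @^-1` U)^° `|` (g @^-1` U `&` Z)); last first.
  apply/seteqP; split => [t Ut|t [/interior_subset//|[]//]].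
  case: (pselect (Z t)) => [|nZ]; [by right | left].
  by apply: cg => //; apply: open_nbhs_nbhs; split => //; exact: interval_open.
apply: measurableU; first by apply: open_measurable; exact: open_interior.
by apply: countable_measurableR; apply: subset_countable cZ => t [].
Qed.

Lemma continuous_continuous_off_countable g :
  continuous g -> continuous_off_countable g.
Proof. by move=> cg; exists set0; [exact: countable0 | move=> y _; exact: cg]. Qed.

Lemma continuous_off_countableD g1 g2 : continuous_off_countable g1 ->
  continuous_off_countable g2 -> continuous_off_countable (fun y => g1 y + g2 y).
Proof.
move=> [Z1 c1 h1] [Z2 c2 h2]; exists (Z1 `|` Z2); first exact: setU_countable.
move=> y nZ; apply: (@continuousD R R^o R g1 g2).
  by apply: h1 => ?; apply: nZ; left.
by apply: h2 => ?; apply: nZ; right.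
Qed.

Lemma continuous_off_countable_sum (I : Type) (s : seq I) (F : I -> R -> R) :
  (forall i, continuous_off_countable (F i)) ->
  continuous_off_countable (fun y => \sum_(i <- s) F i y).
Proof.
move=> cF; elim: s => [|i s IH].
  under [X in continuous_off_countable X]eq_fun do rewrite big_nil.
  by apply: continuous_continuous_off_countable => y; exact: cvg_cst.
under [X in continuous_off_countable X]eq_fun do rewrite big_cons.
exact: continuous_off_countableD.
Qed.

Lemma continuous_off_countable_post g (k : R -> R) : continuous k ->
  continuous_off_countable g -> continuous_off_countable (fun y => k (g y)).
Proof.
move=> ck [Z cZ cg]; exists Z => // y nZ.
by apply: (@continuous_comp R R R g k) => //; [exact: cg | exact: ck].
Qed.

End continuous_off_countable.

(** * Lipschitz majorants of a bounded function *)

Section sup_convolution.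
Context {R : realType} (g : R -> R) (B : R).
Hypothesis g0 : forall y, 0 <= g y.
Hypothesis gB : forall y, g y <= B.

(** The least [j]-Lipschitz majorant of [g]. *)
Definition sup_conv (j : nat) (y : R) := sup [set g z - j%:R * `|y - z| | z in setT].

Lemma sup_conv_ub j y z : g z - j%:R * `|y - z| <= sup_conv j y.
Proof.
apply: ub_le_sup; last by exists z.
exists B => _ [t _ <-]; rewrite (le_trans _ (gB t)) // lerBlDr lerDl.
by rewrite mulr_ge0.
Qed.

Lemma sup_conv_le j y c : (forall z, g z - j%:R * `|y - z| <= c) -> sup_conv j y <= c.
Proof.
move=> h; apply: ge_sup; first by exists (g 0 - j%:R * `|y - 0|), 0.
by move=> _ [z _ <-].
Qed.

Lemma sup_conv_ge j y : g y <= sup_conv j y.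
Proof. by have := sup_conv_ub j y y; rewrite subrr normr0 mulr0 subr0. Qed.

Lemma sup_conv_bound j y : sup_conv j y <= B.
Proof.
apply: sup_conv_le => z; rewrite (le_trans _ (gB z)) // lerBlDr lerDl.
by rewrite mulr_ge0.
Qed.

Lemma sup_conv_lip j y y' : sup_conv j y <= sup_conv j y' + j%:R * `|y - y'|.
Proof.
apply: sup_conv_le => z; rewrite -lerBlDr; apply: le_trans (sup_conv_ub j y' z).
rewrite -addrA lerD2l -opprD lerN2 -mulrDr ler_wpM2l //.
by rewrite [leRHS]addrC (distrC y y') ler_distD.
Qed.

Lemma sup_conv_continuous j : continuous (sup_conv j).
Proof.
move=> y; apply/cvgrPdist_le => e e0.
near=> t.
(* The factor [j.+1] avoids a division by zero when [j = 0]. *)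
have ht : j.+1%:R * `|y - t| <= e.
  rewrite mulrC -ler_pdivlMr //; near: t; apply: cvgr_dist_le => //.
  by rewrite divr_gt0.
have ht' : j%:R * `|y - t| <= e.
  by apply: le_trans ht; rewrite ler_wpM2r // ler_nat.
have := sup_conv_lip j y t; have := sup_conv_lip j t y; rewrite (distrC t).
by move=> h1 h2; rewrite ler_norml; apply/andP; split; lra.
Unshelve. all: by end_near. Qed.

(** Points [z] close to [y] contribute at most [g y + e] by continuity; points at distance at least
    [d] contribute at most [B - j * d], which is nonpositive for large [j]. *)
Lemma sup_conv_cvg y : {for y, continuous g} -> sup_conv ^~ y @ \oo --> g y.
Proof.
move=> /cvgrPdist_le cg; apply/cvgrPdist_le => e e0.
have /nbhs_ballP[d /= d0 hd] := cg _ e0.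
have B0 : 0 <= B by exact: le_trans (g0 y) (gB y).
exists (Num.truncn (B / d)).+1 => // j /= hj.
have Bj : B <= j%:R * d.
  rewrite -ler_pdivrMr //; apply: le_trans (ltW (truncnS_gt _)) _.
  by rewrite ler_nat.
rewrite ler0_norm ?subr_le0 ?sup_conv_ge // opprB lerBlDr.
apply: sup_conv_le => z; have [zd|zd] := ltP `|y - z| d.
  have := hd z zd => /=; rewrite ler_norml => /andP[h _].
  have : 0 <= j%:R * `|y - z| by rewrite mulr_ge0.
  by lra.
have : j%:R * d <= j%:R * `|y - z| by rewrite ler_wpM2l.
by have := gB z; have := g0 y; lra.
Qed.

End sup_convolution.

(** What is needed for composition with [a] to preserve continuity off a countable set, and for
    almost-everywhere statements to be pulled back along [a]. *)
Definition tame {R : realType} (a : R -> R) :=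
  [/\ continuous_off_countable a,
      forall Z : set R, countable Z -> countable (a @^-1` Z) &
      forall E : set (measurableTypeR R), measurable E ->
        lebesgue_measure E = 0%E -> lebesgue_measure (a @^-1` E) = 0%E].

Section tame.
Context {R : realType}.
Implicit Types (g a : R -> R).

Lemma continuous_off_countable_comp g a : continuous_off_countable g ->
  tame a -> continuous_off_countable (g \o a).
Proof.
move=> [Z cZ cg] [[Z' cZ' ca] pa _]; exists (Z' `|` a @^-1` Z).
  by apply: setU_countable => //; exact: pa.
move=> y nZ; apply: continuous_comp; first by apply: ca => h; apply: nZ; left.
by apply: cg => h; apply: nZ; right.
Qed.

Lemma tame_id : tame (@id R).
Proof.
split=> //; apply: continuous_continuous_off_countable => y; exact: cvg_id.
Qed.

Lemma tame_measurable a : tame a ->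
  measurable_fun [set: measurableTypeR R] (a : R -> measurableTypeR R).
Proof. by move=> [ca _ _]; exact: continuous_off_countable_measurable. Qed.

Lemma tame_preimage_measurable a (E : set (measurableTypeR R)) : tame a ->
  measurable E -> measurable (a @^-1` E : set (measurableTypeR R)).
Proof.
by move=> ta mE; rewrite -[X in measurable X]setTI; exact: tame_measurable.
Qed.

Lemma tame_comp a1 a2 : tame a1 -> tame a2 -> tame (a1 \o a2).
Proof.
move=> t1 t2; have [c1 p1 n1] := t1; have [c2 p2 n2] := t2; split.
- exact: continuous_off_countable_comp.
- by move=> Z cZ; rewrite comp_preimage; exact/p2/p1.
- move=> E mE E0; rewrite comp_preimage; apply: n2; last exact: n1.
  exact: tame_preimage_measurable.
Qed.

Lemma tame_iter a n : tame a -> tame (iter n a).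
Proof.
by move=> ta; elim: n => [|n IH]; [exact: tame_id | exact: tame_comp].
Qed.

Lemma tame_ae a (P : R -> Prop) : tame a ->
  {ae lebesgue_measure, forall x, P x} -> {ae lebesgue_measure, forall x, P (a x)}.
Proof.
move=> ta [N [mN N0 sN]]; exists (a @^-1` N); split.
- exact: tame_preimage_measurable.
- by have [_ _] := ta; apply.
- by move=> x /= nP; exact: sN.
Qed.

End tame.

(** * Upper bounds for averages along a generic orbit *)

Section generic_upper_bound.
Context {R : realType} (rho : {measure set (measurableTypeR R) -> \bar R}).
Hypothesis prho : prob_on_unit rho.

Lemma prob_on_unit_setT : rho setT = 1%E.
Proof.
have [h1 h0] := prho; have mu : measurable (unit_itv : set (measurableTypeR R)).
  exact: measurable_itv.
have mC := measurableC mu.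
have := @measureU _ _ _ rho _ _ mu mC (setICr _); rewrite setUv => ->.
by rewrite -[RHS]adde0; congr (_ + _)%E; [exact: h1 | exact: h0].
Qed.

Lemma Rintegral_unit_itv g : bounded_measurable g ->
  \int[rho]_(x in unit_itv) g x = \int[rho]_x g x.
Proof.
move=> bg; rewrite /Rintegral; congr fine.
rewrite [RHS](@negligible_integral _ _ _ _ _ (~` unit_itv)) //.
- by rewrite setTD setCK.
- by apply: measurableC; exact: measurable_itv.
- by apply: bounded_measurable_integrable => //; exact: prob_on_unit_setT.
- exact: prho.2.
Qed.

(** Genericity tests only continuous functions, so [G] is replaced by its continuous majorant
    [sup_conv G j]. The integrals of these majorants converge to that of [G], because they converge
    to [G] off a countable, hence [rho]-null, set. *)
Lemma generic_upper_bound (f : R -> R) (x B : R) (G : R -> R) (e : R) :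
  abs_cont_leb rho -> generic f rho x ->
  (forall y, 0 <= G y) -> (forall y, G y <= B) -> continuous_off_countable G ->
  0 < e ->
  \forall N \near \oo, \sum_(0 <= n < N) G (iter n f x) <= N%:R * (\int[rho]_y G y + e).
Proof.
move=> ac gen G0 GB [Z cZ cG] e0.
have e20 : 0 < e / 2 by rewrite divr_gt0.
have sB j y : `|sup_conv G j y| <= B.
  rewrite ger0_norm ?sup_conv_bound //.
  by apply: le_trans (G0 y) _; apply: sup_conv_ge GB _ _.
have msc j : measurable_fun [set: measurableTypeR R] (sup_conv G j : R -> measurableTypeR R).
  apply: continuous_off_countable_measurable.
  by apply: continuous_continuous_off_countable; exact: sup_conv_continuous GB _.
have : (fun j => \int[rho]_y sup_conv G j y) @ \oo --> \int[rho]_y G y.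
  apply: (bounded_convergence prob_on_unit_setT msc _ sB).
    by apply: continuous_off_countable_measurable; exists Z.
  exists Z; split; first exact: countable_measurableR.
    apply: ac; first exact: countable_measurableR.
    exact: countable_lebesgue_measure0.
  move=> y /= ny; apply: contrapT => nZ; apply: ny.
  by apply: sup_conv_cvg GB _ _ => //; exact: cG.
move=> /cvgrPdist_le/(_ _ e20)[j _ /(_ j (leqnn j)) /= hj].
have := gen (sup_conv G j); rewrite -[fine _]/(\int[rho]_(y in unit_itv) sup_conv G j y).
rewrite Rintegral_unit_itv; last by split; [exact: msc | exists B; exact: sB].
move=> /(_ _)/cvgrPdist_le/(_ _ e20)[|N0 _ hN].
  by apply: continuous_subspaceT; exact: sup_conv_continuous GB _.
exists N0.+1 => // N /= NN; have {}hN := hN N (ltnW NN).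
have N_gt0 : 0 < N%:R :> R by rewrite ltr0n (leq_trans _ NN).
apply: (@le_trans _ _ (\sum_(0 <= n < N) sup_conv G j (iter n f x))).
  by apply: ler_sum => n _; exact: sup_conv_ge GB _ _.
rewrite -ler_pdivrMl //; move: hN hj => /=.
rewrite !ler_norml => /andP[a1 a2] /andP[a3 a4]; lra.
Qed.

End generic_upper_bound.

(** * A criterion for genericity *)

Section clamp.
Context {R : realType}.

(** The retraction of the line onto the unit interval: [g \o clamp] extends a function continuous on
    the interval to a bounded continuous function on the line. *)
Definition clamp (y : R) : R := Num.max 0 (Num.min 1 y).

Lemma clamp_unit y : unit_itv (clamp y).
Proof.
by rewrite /unit_itv /clamp /= in_itv /= le_max lexx ge_max ler01 ge_min lexx.
Qed.

Lemma clamp_id y : unit_itv y -> clamp y = y.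
Proof.
rewrite /unit_itv /clamp /= in_itv /= => /andP[y0 y1].
by rewrite (min_idPr y1) (max_idPr y0).
Qed.

Lemma clamp_continuous : continuous clamp.
Proof.
have lip y t : `|clamp y - clamp t| <= `|y - t|.
  rewrite ler_norml; have h1 := ler_norm (y - t).
  have h2 := ler_norm (t - y); rewrite distrC in h2.
  rewrite /clamp; have [?|?] := leP 1 y; have [?|?] := leP 1 t;
    rewrite ?(max_idPr (@ler01 R)); have [?|?] := leP 0 y; have [?|?] := leP 0 t;
    apply/andP; split; lra.
move=> y; apply/cvgrPdist_le => e e0; near=> t; apply: le_trans (lip y t) _.
by near: t; exact: cvgr_dist_le.
Unshelve. all: by end_near. Qed.

Lemma comp_clamp_continuous (g : R -> R) :
  {within `[0%R, 1%R], continuous g} -> continuous (g \o clamp).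
Proof.
move=> cg y; apply/cvgrPdist_lt => e e0.
have c01 := clamp_unit y.
have : g @ within `[0%R, 1%R] (nbhs (clamp y)) --> g (clamp y).
  rewrite nbhs_subspace_in; first exact: cg.
  exact: c01.
move=> /cvgrPdist_lt/(_ _ e0); rewrite near_withinE => h.
near=> t; suff : (`[0%R, 1%R]%classic (clamp t) -> `|g (clamp y) - g (clamp t)| < e).
  by apply; exact: clamp_unit.
near: t; exact: (@clamp_continuous y _ h).
Unshelve. all: by end_near. Qed.

Lemma comp_clamp_bounded (g : R -> R) :
  {within `[0%R, 1%R], continuous g} -> exists B, forall y, `|g (clamp y)| <= B.
Proof.
move=> cg; have [c1 _ h1] := EVT_max ler01 cg; have [c2 _ h2] := EVT_min ler01 cg.
exists (`|g c1| + `|g c2|) => y.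
have {}h1 := h1 _ (clamp_unit y); have {}h2 := h2 _ (clamp_unit y).
have h3 := ler_norm (g c1); have h4 := ler_norm (- g c2); rewrite normrN in h4.
have := normr_ge0 (g c1); have := normr_ge0 (g c2).
by rewrite ler_norml => h5 h6; apply/andP; split; lra.
Qed.

Lemma continuous_off_countable_indic_unit :
  continuous_off_countable (\1_(unit_itv : set R) : R -> R).
Proof.
exists [set 0; 1]; first exact/finite_set_countable/finite_set2.
move=> y ny; apply: cvg_near_cst.
have y0 : y != 0 by apply/eqP => h; apply: ny; left.
have y1 : y != 1 by apply/eqP => h; apply: ny; right.
have near_lt (u c : R) : u < c -> \forall t \near u, t < c.
  by move=> uc; apply: (@cvgr_lt _ _ (nbhs u) _ id u) => //; exact: cvg_id.
have near_gt (u c : R) : c < u -> \forall t \near u, c < t.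
  by move=> uc; apply: (@cvgr_gt _ _ (nbhs u) _ id u) => //; exact: cvg_id.
have [yl|yg|/eqP h] := ltgtP y 0; last by rewrite h in y0.
- near=> t; rewrite !indicE !memNset // /unit_itv /= in_itv /=.
    by rewrite leNgt yl.
  by rewrite leNgt; have -> : t < 0 by near: t; exact: near_lt.
- have [yl|yg'|/eqP h] := ltgtP y 1; last by rewrite h in y1.
    near=> t; rewrite !indicE !mem_set // /unit_itv /= in_itv /=.
      by rewrite !ltW.
    by apply/andP; split; apply: ltW; near: t; [exact: near_gt | exact: near_lt].
  near=> t; rewrite !indicE !memNset // /unit_itv /= in_itv /= => /andP[_].
    by rewrite leNgt yg'.
  by rewrite leNgt; have -> : 1 < t by near: t; exact: near_gt.
Unshelve. all: by end_near. Qed.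

Lemma continuous_off_countableM (g1 g2 : R -> R) : continuous_off_countable g1 ->
  continuous_off_countable g2 -> continuous_off_countable (fun y => g1 y * g2 y).
Proof.
move=> [Z1 c1 h1] [Z2 c2 h2]; exists (Z1 `|` Z2); first exact: setU_countable.
move=> y nZ; apply: (@continuousM R R g1 g2).
  by apply: h1 => ?; apply: nZ; left.
by apply: h2 => ?; apply: nZ; right.
Qed.

End clamp.

Lemma cvg_sumr0 {R : realType} (I : Type) (s : seq I) (u : I -> nat -> R) :
  (forall i, u i @ \oo --> (0 : R)) ->
  (fun n => \sum_(i <- s) u i n) @ \oo --> (0 : R).
Proof.
move=> u0; elim: s => [|i s IH].
  by under eq_fun do rewrite big_nil; exact: cvg_cst.
under eq_fun do rewrite big_cons.
by have := cvgD (u0 i) IH; rewrite addr0; exact.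
Qed.

Section generic_criterion.
Context {R : realType} (rho rho2 : {measure set (measurableTypeR R) -> \bar R}).
Variables (f f2 : R -> R) (x : R) (C : nat) (I : finType) (a : I -> R -> R).
Hypothesis prho : prob_on_unit rho.
Hypothesis tf : tame f.
Hypothesis f01 : forall y, unit_itv (f y) <-> unit_itv y.
Hypothesis ergo : forall g, bounded_measurable g ->
  {ae lebesgue_measure, forall y, unit_itv y ->
    (fun N : nat => N%:R^-1 * \sum_(0 <= n < N) g (iter n f y)) @ \oo -->
      \int[rho]_x g x}.
Hypothesis prho2 : prob_on_unit rho2.
Hypothesis ac2 : abs_cont_leb rho2.
Hypothesis gen2 : generic f2 rho2 x.
Hypothesis x01 : unit_itv x.
Hypothesis C0 : (0 < C)%N.
Hypothesis ta : forall i, tame (a i).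
Hypothesis dom : forall g : R -> R, (forall y, 0 <= g y) ->
  (forall y, ~ unit_itv y -> g y = 0) -> forall N : nat,
  \sum_(0 <= n < N) g (iter n f x) <=
    \sum_(0 <= n < C * N) \sum_i g (a i (iter n f2 x)).

Let avg (phi : R -> R) (K : nat) y := K%:R^-1 * \sum_(0 <= n < K) phi (iter n f y).

Lemma iter_unit n : unit_itv (iter n f x).
Proof. by elim: n => //= n; apply: (f01 _).2. Qed.

Lemma avg_bounded phi B K y : (forall y, `|phi y| <= B) -> `|avg phi K y| <= B.
Proof.
move=> hB; have B0 : 0 <= B by exact: le_trans (normr_ge0 _) (hB 0).
case: K => [|K]; first by rewrite /avg big_geq // mulr0 normr0.
rewrite /avg normrM gtr0_norm ?invr_gt0 // ler_pdivrMl //.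
apply: le_trans (ler_norm_sum _ _ _) _.
rewrite [leRHS]mulr_natl -[X in _ <= _ *+ X]subn0 -sumr_const_nat; exact: ler_sum.
Qed.

(* Averaging the block averages [avg phi K] along the orbit changes the
   Birkhoff sum only by boundary terms. *)
Lemma sum_avg phi B K N : (forall y, `|phi y| <= B) -> (0 < K)%N ->
  `|\sum_(0 <= n < N) phi (iter n f x) - \sum_(0 <= n < N) avg phi K (iter n f x)|
     <= K%:R * (2 * B).
Proof.
move=> hB K0; have B0 : 0 <= B by exact: le_trans (normr_ge0 _) (hB 0).
have K0' : 0 < K%:R :> R by rewrite ltr0n.
pose s j := \sum_(0 <= n < N) phi (iter (n + j) f x).
have sS j : `|s j.+1 - s j| <= 2 * B.
  have -> : s j.+1 - s j = phi (iter (N + j) f x) - phi (iter j f x).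
    have /= <- := telescope_sumr (fun n => phi (iter (n + j) f x)) (leq0n N).
    by rewrite /s -sumrB; apply: eq_bigr => n _; rewrite addnS.
  by apply: le_trans (ler_normB _ _) _; rewrite mulr_natl mulr2n lerD.
have sj j : `|s j - s 0%N| <= j%:R * (2 * B).
  elim: j => [|j IH]; first by rewrite subrr normr0 mul0r.
  apply: le_trans (ler_distD (s j) _ _) _.
  by rewrite -natr1 mulrDl mul1r addrC lerD.
have -> : \sum_(0 <= n < N) avg phi K (iter n f x) = K%:R^-1 * \sum_(0 <= j < K) s j.
  rewrite /avg -mulr_sumr; congr (_ * _); rewrite exchange_big /=.
  apply: eq_bigr => j _; apply: eq_bigr => n _.
  by rewrite -iterD addnC.
have -> : \sum_(0 <= n < N) phi (iter n f x) = K%:R^-1 * \sum_(0 <= j < K) s 0%N.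
  rewrite sumr_const_nat subn0 -[s 0%N *+ K]mulr_natl mulrA mulVf ?gt_eqF // mul1r.
  by apply: eq_bigr => n _; rewrite addn0.
rewrite -mulrBr -sumrB normrM gtr0_norm ?invr_gt0 // ler_pdivrMl //.
apply: le_trans (ler_norm_sum _ _ _) _.
rewrite [leRHS]mulr_natl -[X in _ <= _ *+ X]subn0 -sumr_const_nat; apply: ler_sum_nat => j /andP[_ jK].
rewrite distrC; apply: le_trans (sj j) _.
by rewrite ler_wpM2r ?mulr_ge0 // ler_nat ltnW.
Qed.

(** By [sum_avg] the sums of [phi] may be replaced by those of the block averages [avg phi K], whose
    deviation from the mean is [g K] on the interval. Hypothesis [dom] carries the sums of [g K] to
    the orbit of [f2], where [generic_upper_bound] controls them by the [rho2]-integral of [G K];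
    this integral tends to 0 by Birkhoff convergence. *)
Lemma generic_criterion : generic f rho x.
Proof.
move=> phi0 cphi0.
have [B hB] := comp_clamp_bounded cphi0.
have cphi := comp_clamp_continuous cphi0.
set phi := phi0 \o clamp in cphi.
have bphi : bounded_measurable phi.
  split; last by exists B.
  by apply: continuous_off_countable_measurable; exact: continuous_continuous_off_countable.
have -> : fine (\int[rho]_(y in unit_itv) (phi0 y)%:E) = \int[rho]_y phi y.
  rewrite -(Rintegral_unit_itv prho bphi); apply: eq_Rintegral => y /set_mem yu.
  by rewrite /phi /= clamp_id.
set m := \int[rho]_y phi y.
have -> : (fun N : nat => N%:R^-1 * \sum_(0 <= n < N) phi0 (iter n f x)) = avg phi ^~ x.
  apply/funext => N; rewrite /avg; congr (_ * _); apply: eq_bigr => n _.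
  by rewrite /phi /= clamp_id //; exact: iter_unit.
(* The indicator is there because convergence is known only inside the unit interval, and because
   [dom] asks for functions vanishing outside. *)
pose g K y := \1_(unit_itv : set R) y * `|avg phi K y - m|.
have cg K : continuous_off_countable (g K).
  apply: continuous_off_countableM; first exact: continuous_off_countable_indic_unit.
  apply: (@continuous_off_countable_post _ (avg phi K) (fun t => `|t - m|)).
    move=> t; apply: (@continuous_comp _ _ _ (fun t => t - m) Num.norm).
      by apply: cvgB; [exact: cvg_id | exact: cvg_cst].
    exact: norm_continuous.
  apply: (@continuous_off_countable_post _ _ (fun t => K%:R^-1 * t)).
    exact: mulrl_continuous.
  apply: continuous_off_countable_sum => n.
  apply: continuous_off_countable_comp; last exact: tame_iter.
  exact: continuous_continuous_off_countable.
have g0 K y : 0 <= g K y by rewrite mulr_ge0 // indicE.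
have gB K y : g K y <= B + `|m|.
  have BI : 0 <= B + `|m| by rewrite addr_ge0 // (le_trans (normr_ge0 _) (hB 0)).
  rewrite /g indicE; case: (_ \in _); rewrite ?mul0r // mul1r.
  by apply: le_trans (ler_normB _ _) _; rewrite lerD2r; exact: avg_bounded.
have F := ae_filter_ringOfSetsType (@lebesgue_measure R).
have gc : {ae lebesgue_measure, forall y, g ^~ y @ \oo --> (0 : R)}.
  apply: filterS (ergo bphi) => y hy; rewrite /g indicE.
  case: (boolP (y \in _)) => [/set_mem yu|_]; last first.
    by under eq_fun do rewrite mul0r; exact: cvg_cst.
  under eq_fun do rewrite mul1r.
  apply/cvgrPdist_le => e e0; have /cvgrPdist_le/(_ _ e0) := hy yu.
  by apply: filterS => n; rewrite sub0r normrN normr_id distrC.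
pose G K y := \sum_i g K (a i y).
have cG K : continuous_off_countable (G K).
  apply: continuous_off_countable_sum => i.
  exact: continuous_off_countable_comp.
have G0 K y : 0 <= G K y by exact: sumr_ge0.
have GB K y : G K y <= (B + `|m|) *+ #|I|.
  by rewrite -sumr_const; exact: ler_sum.
have Gc : {ae rho2, forall y, G ^~ y @ \oo --> (0 : R)}.
  apply: abs_cont_ae => //.
  have : {ae lebesgue_measure, forall y, forall i : I, g ^~ (a i y) @ \oo --> (0 : R)}.
    (* The finite family is enumerated through [pickle], so that countable intersection of
       almost-sure events applies. *)
    have h : {ae lebesgue_measure, forall y, forall n : nat,
        if unpickle n is Some i then g ^~ (a (i : I) y) @ \oo --> (0 : R) else True}.
      apply: ae_foralln => n; case: unpickle => [i|]; last exact: aeW.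
      exact: (@tame_ae _ (a i) (fun y => g ^~ y @ \oo --> (0 : R))).
    by apply: filterS h => y h i; have := h (pickle i); rewrite pickleK.
  apply: filterS => y hy; rewrite /G.
  exact: cvg_sumr0.
have iG : (fun K => \int[rho2]_y G K y) @ \oo --> (0 : R).
  rewrite -(Rintegral_cst1 (prob_on_unit_setT prho2) 0).
  apply: (bounded_convergence (prob_on_unit_setT prho2) _ _ _ Gc) => [n||n y].
  - exact: continuous_off_countable_measurable.
  - exact: measurable_cst.
  - by rewrite ger0_norm // GB.
apply/cvgrPdist_le => e e0.
(* There will be [C * N] terms, each costing on average [e1] for the integral of [G K] and [e1] for
   genericity, which totals [N * (e / 2)]. *)
pose e1 := e / 2 / (2 * C%:R).
have e10 : 0 < e1 by rewrite !divr_gt0 // mulr_gt0 // ltr0n.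
have [K0 _ hK] := (cvgrPdist_le _ _).1 iG _ e10.
pose K := K0.+1; have {}hK : \int[rho2]_y G K y <= e1.
  have := hK K (leqW (leqnn _)); rewrite /= sub0r normrN.
  exact: le_trans (ler_norm _).
have [M0 _ hM] := generic_upper_bound prho2 ac2 gen2 (G0 K) (GB K) (cG K) e10.
(* The second threshold makes the boundary term of [sum_avg] at most [N * (e / 2)]. *)
exists (maxn M0 (Num.truncn (K%:R * (2 * B) / (e / 2))).+1) => // N /=.
rewrite geq_max => /andP[MN KN].
have N0 : 0 < N%:R :> R by rewrite ltr0n (leq_trans _ KN).
have h1 := sum_avg N hB (ltn0Sn K0); rewrite -/K in h1.
have h2 : K%:R * (2 * B) <= N%:R * (e / 2).
  rewrite -ler_pdivrMr ?divr_gt0 //; apply: le_trans (ltW (truncnS_gt _)) _.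
  by rewrite ler_nat.
have h3 : \sum_(0 <= n < N) `|avg phi K (iter n f x) - m| <= N%:R * (e / 2).
  have -> : \sum_(0 <= n < N) `|avg phi K (iter n f x) - m| = \sum_(0 <= n < N) g K (iter n f x).
    apply: eq_bigr => n _; rewrite /g indicE mem_set ?mul1r //; exact: iter_unit.
  apply: le_trans (dom (g0 K) _ N) _.
    by move=> y yu; rewrite /g indicE memNset // mul0r.
  apply: le_trans (hM (C * N)%N _) _.
    by rewrite /= (leq_trans MN) // leq_pmull.
  apply: (@le_trans _ _ ((C * N)%:R * (e1 + e1))).
    by rewrite ler_wpM2l // lerD2r.
  rewrite /e1 natrM; set c := C%:R; have c0 : c != 0 by rewrite pnatr_eq0 -lt0n.
  by rewrite [leLHS](_ : _ = N%:R * (e / 2)) //; field.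
have h4 : `|\sum_(0 <= n < N) (avg phi K (iter n f x) - m)| <= N%:R * (e / 2).
  exact: le_trans (ler_norm_sum _ _ _) h3.
rewrite sumrB sumr_const_nat subn0 -mulr_natl in h4.
rewrite /avg; set s := \sum_(0 <= n < N) phi (iter n f x) in h1 *.
have -> : m - N%:R^-1 * s = N%:R^-1 * (N%:R * m - s).
  by rewrite mulrBr mulKf // gt_eqF.
rewrite normrM gtr0_norm ?invr_gt0 // ler_pdivrMl //.
have := le_trans h1 h2; move: h4; rewrite !ler_norml => /andP[a1 a2] /andP[a3 a4].
by apply/andP; split; lra.
Qed.

End generic_criterion.

(** * Piecewise affine maps of the unit interval *)

(** The identity outside the interval makes both the interval and its complement invariant, so the
    results for maps of the whole line apply. *)
Definition unit_ext {R : realType} (f : R -> R) (y : R) : R :=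
  if y \in `[0, 1] then f y else y.

Section affine.
Context {R : realType}.

(** By uniqueness of Lebesgue measure it suffices to compare it with [|a|] times the pushforward on
    half-open intervals; a negative slope reverses their endpoints. *)
Lemma lebesgue_measure_affine_preimage (a c : R) (E : set (measurableTypeR R)) :
  a != 0 -> measurable E ->
  lebesgue_measure ((fun y => a * y + c) @^-1` E) = (`|a|^-1%:E * lebesgue_measure E)%E.
Proof.
move=> a0 mE; pose h (y : measurableTypeR R) : measurableTypeR R := a * y + c.
have mh : measurable_fun [set: measurableTypeR R] h.
  apply: continuous_measurable_fun => y.
  by apply: cvgD; [exact: mulrl_continuous | exact: cvg_cst].
pose pf : {measure set (measurableTypeR R) -> \bar R} := pushforward lebesgue_measure h.
have na : 0 < `|a| by rewrite normr_gt0.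
pose sc : {measure set (measurableTypeR R) -> \bar R} :=
  mscale (NngNum (normr_ge0 a)) (pf mh).
have : lebesgue_measure E = sc E.
  apply: lebesgue_measure_unique => //= _ [[x y] _ <-] /=.
  rewrite /mscale /= /pushforward /=.
  have [agt|alt|/eqP h0] := ltgtP 0 a; last by rewrite eq_sym h0 in a0.
    rewrite (_ : h @^-1` _ = `](x - c) / a, (y - c) / a]%classic); last first.
      apply/seteqP; split => t; rewrite /h /= !in_itv /= ltr_pdivrMr // ler_pdivlMr //;
        by rewrite ltrBlDr lerBrDr mulrC.
    rewrite !lebesgue_measure_itv /= !lte_fin ltr_pM2r ?invr_gt0 // ltrD2r.
    case: ifP => _; last by rewrite mule0.
    by rewrite -!EFinD -EFinM gtr0_norm //; congr EFin; field.
  rewrite (_ : h @^-1` _ = `[(y - c) / a, (x - c) / a[%classic); last first.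
    apply/seteqP; split => t; rewrite /h /= !in_itv /= ler_ndivrMr // ltr_ndivlMr //;
      by rewrite ltrBlDr lerBrDr mulrC andbC.
  rewrite !lebesgue_measure_itv /= !lte_fin ltr_nM2r ?invr_lt0 // ltrD2r.
  case: ifP => _; last by rewrite mule0.
  by rewrite -!EFinD -EFinM ltr0_norm //; congr EFin; field.
rewrite /sc /= /mscale /= /pushforward => ->.
by rewrite muleA -EFinM mulVf ?gt_eqF // mul1e.
Qed.

Lemma affine_preimage_countable (a c : R) (Z : set R) : a != 0 -> countable Z ->
  countable ((fun y => a * y + c) @^-1` Z).
Proof.
move=> a0 cZ; apply: subset_countable (image_countable (fun z => (z - c) / a) cZ).
by move=> y Zy; exists (a * y + c) => //; rewrite addrK mulrAC mulfV // mul1r.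
Qed.

Lemma affine_continuous (a c : R) : continuous (fun y => a * y + c).
Proof.
by move=> y; apply: cvgD; [exact: mulrl_continuous | exact: cvg_cst].
Qed.

Lemma tame_affine (a c : R) : a != 0 -> tame (fun y => a * y + c).
Proof.
move=> a0; split.
- by apply: continuous_continuous_off_countable; exact: affine_continuous.
- by move=> Z; exact: affine_preimage_countable.
- by move=> E mE E0; rewrite lebesgue_measure_affine_preimage // E0 mule0.
Qed.

End affine.

Section unit_ext.
Context {R : realType}.
Implicit Types f : R -> R.

Lemma unit_ext_in f y : unit_itv y -> unit_ext f y = f y.
Proof. by move=> yu; rewrite /unit_ext ifT. Qed.

Lemma unit_ext_notin f y : ~ unit_itv y -> unit_ext f y = y.
Proof. by move=> yu; rewrite /unit_ext ifF //; exact/negP. Qed.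

Lemma unit_ext_unit f y : (forall y, unit_itv y -> unit_itv (f y)) ->
  unit_itv (unit_ext f y) <-> unit_itv y.
Proof.
move=> fu; case: (pselect (unit_itv y)) => yu; last by rewrite unit_ext_notin.
by rewrite unit_ext_in //; split => // _; exact: fu.
Qed.

Lemma iter_unit_ext f n y : (forall y, unit_itv y -> unit_itv (f y)) ->
  unit_itv y -> iter n (unit_ext f) y = iter n f y /\ unit_itv (iter n f y).
Proof.
move=> fu yu; elim: n => [|n [IH IHu]] //=; rewrite IH unit_ext_in //.
by split => //; exact: fu.
Qed.

Lemma generic_unit_ext f (rho : {measure set (measurableTypeR R) -> \bar R}) x :
  (forall y, unit_itv y -> unit_itv (f y)) -> unit_itv x ->
  generic (unit_ext f) rho x = generic f rho x.
Proof.
move=> fu xu; have e (g : R -> R) :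
    (fun N : nat => N%:R^-1 * \sum_(0 <= n < N) g (iter n (unit_ext f) x)) =
    (fun N : nat => N%:R^-1 * \sum_(0 <= n < N) g (iter n f x)).
  apply/funext => N; congr (_ * _); apply: eq_bigr => n _.
  by have [->] := iter_unit_ext n fu xu.
by apply/propext; split => h g cg; have := h g cg; rewrite e.
Qed.

Lemma prob_on_unitI (rho : {measure set (measurableTypeR R) -> \bar R})
    (A : set (measurableTypeR R)) : prob_on_unit rho ->
  measurable A -> rho A = rho (A `&` unit_itv).
Proof.
move=> [_ r0] mA; have mu : measurable (unit_itv : set (measurableTypeR R)).
  exact: measurable_itv.
rewrite (measureDI rho mA mu); set X := (X in (rho X + _)%E).
have -> : rho X = 0%E; last by rewrite add0e.
apply/eqP; rewrite eq_le measure_ge0 andbT -[leRHS]r0 le_measure ?inE //.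
- exact: measurableD.
- exact: measurableC.
- by move=> y [].
Qed.

Lemma unit_ext_invariant f (rho : {measure set (measurableTypeR R) -> \bar R}) :
  (forall y, unit_itv y -> unit_itv (f y)) -> tame (unit_ext f) ->
  prob_on_unit rho -> preserves f rho ->
  forall E : set (measurableTypeR R), measurable E ->
    rho (unit_ext f @^-1` E) = rho E.
Proof.
move=> fu tf pr pf E mE.
have mu : measurable (unit_itv : set (measurableTypeR R)) by exact: measurable_itv.
rewrite (prob_on_unitI pr (tame_preimage_measurable tf mE)) (prob_on_unitI pr mE).
rewrite -[RHS]pf; [|exact: measurableI|by move=> y []].
congr (rho _); apply/seteqP; split => y /=.
  by move=> [h yu]; rewrite unit_ext_in // in h; split => //; split => //; exact: fu.
by move=> [yu [h _]]; rewrite unit_ext_in.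
Qed.

(** Away from the ends of the pieces, the map agrees locally with one affine map, or with the
    identity outside the interval. The preimage of a set lies in that set together with its
    countably many affine preimages, which gives the other two conditions. *)
Lemma tame_piecewise f (I : countType) (J : I -> set R) (al ga : I -> R) :
  (forall i x y z, J i x -> J i z -> x <= y <= z -> J i y) ->
  (forall i, J i `<=` unit_itv) ->
  (forall y, unit_itv y -> exists i, J i y) ->
  (forall i, al i != 0) ->
  (forall i y, J i y -> f y = al i * y + ga i) -> tame (unit_ext f).
Proof.
move=> Jc Ju Jcov al0 fJ.
have mu : measurable (unit_itv : set (measurableTypeR R)) by exact: measurable_itv.
(* Ends are least and greatest elements of the piece, which covers open, closed, half-open and
   singleton pieces alike. *)
pose Z i := [set y | J i y /\ forall u, J i u -> y <= u] `|`
            [set y | J i y /\ forall u, J i u -> u <= y].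
have cZ : countable (\bigcup_i Z i).
  apply: bigcup_countable => // i _; apply: setU_countable.
    case: (pselect (exists y, J i y /\ forall u, J i u -> y <= u)) => [[y [Jy hy]]|no].
      apply: subset_countable (countable1 y) => t [Jt ht] /=.
      by apply/eqP; rewrite eq_le ht // hy.
    by apply: subset_countable (@countable0 R) => t ht; apply: no; exists t.
  case: (pselect (exists y, J i y /\ forall u, J i u -> u <= y)) => [[y [Jy hy]]|no].
    apply: subset_countable (countable1 y) => t [Jt ht] /=.
    by apply/eqP; rewrite eq_le ht // hy.
  by apply: subset_countable (@countable0 R) => t ht; apply: no; exists t.
have cf : continuous_off_countable (unit_ext f).
  exists (\bigcup_i Z i) => // y nZ.
  case: (pselect (unit_itv y)) => yu.
    have [i Ji] := Jcov y yu.
    have [u Ju' uy] : exists2 u, J i u & u < y.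
      apply: contrapT => no; apply: nZ; exists i => //; left; split => // u Jiu.
      by rewrite leNgt; apply/negP => uy; apply: no; exists u.
    have [v Jv yv] : exists2 v, J i v & y < v.
      apply: contrapT => no; apply: nZ; exists i => //; right; split => // v Jiv.
      by rewrite leNgt; apply/negP => yv; apply: no; exists v.
    rewrite /prop_for /continuous_at (_ : unit_ext f y = al i * y + ga i); last first.
      by rewrite unit_ext_in // (fJ i).
    apply: (cvg_trans _ (@affine_continuous R (al i) (ga i) y)).
    apply: near_eq_cvg.
    have : \forall t \near y, t \in `]u, v[ by apply: near_in_itvoo; rewrite in_itv /= uy yv.
    apply: filterS => t; rewrite in_itv /= => /andP[ut tv].
    have Jt : J i t by apply: (Jc i u t v) => //; rewrite !ltW.
    by rewrite unit_ext_in ?(fJ i) //; exact: Ju Jt.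
  rewrite /prop_for /continuous_at (unit_ext_notin _ yu).
  apply: (cvg_trans _ (@cvg_id _ (nbhs y))); apply: near_eq_cvg.
  have : open (~` `[0%R, 1%R]%classic : set R).
    by rewrite openC; exact: interval_closed.
  move=> oC; have := open_nbhs_nbhs (conj oC yu).
  by apply: filterS => t tn; rewrite unit_ext_notin.
split => //.
- move=> A cA; pose W := A `|` \bigcup_i ((fun y => al i * y + ga i) @^-1` A).
  apply: (@subset_countable _ _ W); last first.
    apply: setU_countable => //; apply: bigcup_countable => // i _.
    exact: affine_preimage_countable.
  move=> y; case: (pselect (unit_itv y)) => yu /=.
    have [i Ji] := Jcov y yu; rewrite unit_ext_in // (fJ i) // => h.
    by right; exists i.
  by rewrite unit_ext_notin // => h; left.
- move=> E mE E0; apply: measure_negligible.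
    rewrite -[X in measurable X]setTI.
    exact: (continuous_off_countable_measurable cf).
  pose W n : set (measurableTypeR R) := if (unpickle n : option I) is Some i
    then (fun y => al i * y + ga i) @^-1` E else set0.
  apply: (@negligibleS _ _ _ _ (E `|` \bigcup_n W n)).
    move=> y; case: (pselect (unit_itv y)) => yu /=.
      have [i Ji] := Jcov y yu; rewrite unit_ext_in // (fJ i) // => h.
      by right; exists (pickle i) => //; rewrite /W pickleK.
    by rewrite unit_ext_notin // => h; left.
  apply: negligibleU; first by exists E; split.
  apply: negligible_bigcup => n; rewrite /W; case: unpickle => [i|]; last exact: negligible_set0.
  have [_ _ h] := tame_affine (ga i) (al0 i).
  exists ((fun y => al i * y + ga i) @^-1` E); split => //; last exact: h.
  exact: tame_preimage_measurable (tame_affine (ga i) (al0 i)) mE.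
Qed.

End unit_ext.

(** * Differences between coupled orbits *)

Lemma intr_poly_denominator (q : {poly rat}) :
  exists2 a : int, a != 0 & exists Q : {poly int}, map_poly intr Q = a%:~R *: q.
Proof.
have [Q [a a0 ->]] := rat_poly_scale q; exists a => //; exists Q.
by rewrite scalerA mulfV ?scale1r // intr_eq0.
Qed.

Section finite_differences.
Context {R : realType} (b : R) (p : {poly int}).
Hypothesis b1 : 1 < b.
Hypothesis mp : p \is monic.
Hypothesis irr : irreducible_poly (map_poly (intr : int -> rat) p).
Hypothesis rb : root (map_poly intr p) b.
Hypothesis conj_lt1 : forall z : R[i], root (map_poly intr p) z ->
  z != (b%:C)%C -> `|z| < 1.

Let D0 : nat := Num.truncn b.

Lemma digit_bound y : unit_itv y -> `|Num.floor (b * y)|%R <= D0%:Z.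
Proof.
rewrite /unit_itv /= in_itv /= => /andP[y0 y1].
have by0 : 0 <= b * y by rewrite mulr_ge0 // ltW // (lt_trans _ b1).
have f0 : 0 <= Num.floor (b * y) by rewrite floor_ge0.
rewrite ger0_norm // -ltzD1 -(@ltr_int R).
apply: le_lt_trans (floor_le _) _.
have h : b < D0.+1%:R by exact: truncnS_gt.
rewrite intrD -natr1 in h *; apply: le_lt_trans h.
by rewrite -[leRHS]mulr1 ler_wpM2l // ltW // (lt_trans _ b1).
Qed.

Lemma beta_map_unit y : unit_itv (beta_map b y).
Proof.
rewrite /unit_itv /= in_itv /= /beta_map subr_ge0 floor_le /=.
by rewrite lerBlDl ltW // -intrD1 floorD1_gt.
Qed.

(** The digits produced along the orbit become the coefficients of [t]; each is at most [D0] in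
    absolute value, whence the bound on the closed unit disc. *)
Lemma iter_beta_map_poly n y : unit_itv y -> exists t : {poly int},
  iter n (beta_map b) y = b ^+ n * y - (map_poly intr t).[b] /\
  forall z : R[i], `|z| <= 1 -> `|(map_poly intr t).[z]| <= (n * D0)%:R.
Proof.
move=> yu; elim: n => [|n [t [e ht]]].
  exists 0; split; first by rewrite rmorph0 horner0 subr0 mul1r.
  by move=> z _; rewrite rmorph0 horner0 normr0.
set w := iter n (beta_map b) y in e *.
have wu : unit_itv w.
  by rewrite /w; case: (n) => // k; exact: beta_map_unit.
exists ('X * t + (Num.floor (b * w))%:P); split.
  rewrite iterS -/w {1}/beta_map rmorphD rmorphM /= map_polyX map_polyC /= !hornerE.
  by rewrite {1}e exprS; ring.
move=> z z1; rewrite rmorphD rmorphM /= map_polyX map_polyC /= !hornerE.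
apply: le_trans (ler_normD _ _) _; rewrite mulSn addnC natrD lerD //.
  by rewrite normrM -[leRHS]mul1r ler_pM // ht.
rewrite -intr_norm -[D0%:R]/(D0%:Z%:~R) ler_int; exact: digit_bound.
Qed.

(** Both orbits are expanded by the same power of [b], so the difference is multiplied by
    [eps i * b ^+ m i] and receives a bounded term of [Q(b)] at each step. Times [D], it is the
    value at [b] of an integer polynomial; there it is bounded since both orbits stay in the
    interval, while at the other conjugates the recursion contracts. Then [pisot_finite] applies. *)
Lemma skew_differences_finite (l : nat) (eps bb : 'I_l -> R) (m : 'I_l -> nat) :
  (forall i, eps i = 1 \/ eps i = -1) -> (forall i, in_Qbeta b (bb i)) ->
  (forall i, (0 < m i)%N) ->
  exists F : seq R, forall (i : nat -> 'I_l) (u v s : nat -> R),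
    u 0%N = v 0%N -> s 0%N = 1 ->
    (forall k, unit_itv (u k)) -> (forall k, unit_itv (v k)) ->
    (forall k, u k.+1 = eps (i k) * b ^+ m (i k) * u k + bb (i k)) ->
    (forall k, v k.+1 = iter (m (i k)) (beta_map b) (v k)) ->
    (forall k, s k.+1 = eps (i k) * s k) ->
    forall k, u k - s k * v k \in F.
Proof.
move=> heps hbb m0.
have /choice[e he] : forall i, exists e : int, eps i = e%:~R /\ `|e| = 1.
  by move=> i; case: (heps i) => ->; [exists 1 | exists (-1)].
have /choice[aQ haQ] : forall i, exists aQ : int * {poly int},
    aQ.1 != 0 /\ aQ.1%:~R * bb i = (map_poly intr aQ.2).[b].
  move=> i.
  have [q hq] := hbb i; have [a a0 [Q hQ]] := intr_poly_denominator q.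
  exists (a, Q); split => //=; rewrite hq.
  have -> : map_poly (intr : int -> R) Q = map_poly (ratr : rat -> R) (map_poly intr Q).
    by rewrite -map_poly_comp; apply: eq_map_poly => z /=; rewrite ratr_int.
  by rewrite hQ map_polyZ /= hornerZ ratr_int.
(* A common denominator of all the translations [bb i]. *)
pose D := \prod_i (aQ i).1.
have D0' : D != 0 by apply/prodf_neq0 => i _; exact: (haQ i).1.
pose Q i := (\prod_(j | j != i) (aQ j).1)%:P * (aQ i).2.
have hQ i : D%:~R * bb i = (map_poly intr (Q i)).[b].
  rewrite /Q rmorphM /= map_polyC /= !hornerE -(haQ i).2 mulrA -intrM.
  by rewrite /D (bigD1 i) //= [(aQ i).1 * _]mulrC.
pose K (z : R[i]) : R[i] :=
  \sum_i (`|(map_poly intr (Q i)).[z]| + `|D|%:~R * (m i * D0)%:R).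
(* The fixed point of [r -> |z| * r + K z], hence a bound preserved by the recursion. *)
pose B z := K z / (1 - `|z|).
have Kge0 z : 0 <= K z.
  rewrite /K; apply: sumr_ge0 => j _.
  by apply: addr_ge0 => //; apply: mulr_ge0; rewrite ?ler0z ?ler0n.
have K0 z i : `|(map_poly intr (Q i)).[z]| + `|D|%:~R * (m i * D0)%:R <= K z.
  rewrite /K (bigD1 i) //= lerDl; apply: sumr_ge0 => j _.
  by apply: addr_ge0 => //; apply: mulr_ge0; rewrite ?ler0z ?ler0n.
have [F hF] := pisot_finite (`|D|%:~R * 2) B mp irr rb.
exists [seq w / D%:~R | w <- F] => i u v s uv0 s0 uu vu hu hv hs.
have DR : D%:~R != 0 :> R by rewrite intr_eq0.
suff inv k : exists q : {poly int}, exists sg : int, [/\ s k = sg%:~R, `|sg| = 1,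
    D%:~R * (u k - s k * v k) = (map_poly intr q).[b] &
    forall z : R[i], root (map_poly intr p) z -> z != (b%:C)%C ->
      `|(map_poly intr q).[z]| <= B z].
  move=> k; have [q [sg [hsg sg1 hq qB]]] := inv k.
  have -> : u k - s k * v k = (map_poly intr q).[b] / D%:~R.
    by rewrite -hq mulrAC mulfV // mul1r.
  apply: map_f; apply: hF => //; rewrite -hq normrM -intr_norm ler_wpM2l ?ler0z //.
  have := uu k; have := vu k; rewrite /unit_itv /= !in_itv /= => /andP[? ?] /andP[? ?].
  apply: le_trans (ler_normB _ _) _; rewrite normrM hsg -intr_norm sg1 mul1r.
  by rewrite !ger0_norm //; lra.
elim: k => [|k [q [sg [hsg sg1 hq qB]]]].
  exists 0, 1; split => //; first by rewrite uv0 s0 mul1r subrr mulr0 rmorph0 horner0.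
  move=> z rz zb; rewrite rmorph0 horner0 normr0 /B divr_ge0 //.
  by rewrite subr_ge0 ltW // conj_lt1.
have [t [ht tB]] := iter_beta_map_poly (m (i k)) (vu k).
have [eE e1] := he (i k).
exists ((e (i k))%:P * 'X^(m (i k)) * q + Q (i k) + (D * e (i k) * sg)%:P * t).
exists (e (i k) * sg); split.
- by rewrite hs hsg eE -intrM.
- by rewrite normrM e1 sg1.
- rewrite 2!rmorphD 3!rmorphM /= !map_polyC /= map_polyXn !hornerE -hQ -hq.
  by rewrite hu hv hs ht eE hsg !intrM; ring.
move=> z rz zb; have z1 := conj_lt1 rz zb.
rewrite 2!rmorphD 3!rmorphM /= !map_polyC /= map_polyXn !hornerE.
apply: le_trans (ler_normD _ _) _.
apply: (@le_trans _ _ (`|z| * B z + K z)); last first.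
  rewrite /B le_eqVlt; apply/orP; left; apply/eqP; field.
  by rewrite subr_eq0 gt_eqF.
apply: le_trans (lerD (ler_normD _ _) (lexx _)) _; rewrite -addrA lerD //.
  rewrite 2!normrM -intr_norm e1 mul1r normrX; apply: ler_pM => //; last exact: qB.
  (* Positivity of the exponent gives [|z| ^+ m <= |z|], a contraction independent of the piece. *)
  by rewrite -(prednK (m0 (i k))) exprS ler_piMr // exprn_ile1 // ltW.
apply: le_trans (K0 z (i k)); rewrite lerD2l normrM -intr_norm !normrM e1 sg1 !mulr1.
by rewrite ler_wpM2l ?ler0z // tB // ltW.
Qed.

(** The same contraction argument for the recursion obeyed by [cylinder_top], where each step either
    resets to 1 or subtracts a digit after multiplication by [b]. *)
Lemma beta_remainders_finite : exists F : seq R, forall s : nat -> R,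
  s 0%N = 1 -> (forall n, 0 <= s n <= 1) ->
  (forall n, s n.+1 = 1 \/
    exists2 d : int, `|d| <= D0%:Z & s n.+1 = b * s n - d%:~R) ->
  forall n, s n \in F.
Proof.
(* The summand [D0] absorbs a digit, and the summand 1 makes [B z >= 1], as the resets require. *)
pose K : R[i] := 1 + D0%:R; pose B (z : R[i]) := K / (1 - `|z|).
have [F hF] := pisot_finite 1 B mp irr rb; exists F => s s0 s01 hs n.
have B1 z : `|z| < 1 -> 1 <= B z.
  move=> z1; rewrite ler_pdivlMr ?subr_gt0 // mul1r /K lerD2l.
  by rewrite (@le_trans _ _ 0) // oppr_le0.
suff [q hq qB] : exists2 q : {poly int}, s n = (map_poly intr q).[b] &
    forall z : R[i], root (map_poly intr p) z -> z != (b%:C)%C ->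
      `|(map_poly intr q).[z]| <= B z.
  rewrite hq; apply: hF => //; rewrite -hq.
  by have /andP[h0 h1] := s01 n; rewrite ger0_norm.
have one : exists2 q : {poly int}, 1 = (map_poly intr q).[b] &
    forall z : R[i], root (map_poly intr p) z -> z != (b%:C)%C ->
      `|(map_poly intr q).[z]| <= B z.
  exists 1; first by rewrite rmorph1 hornerC.
  by move=> z rz zb; rewrite rmorph1 hornerC normr1 B1 // conj_lt1.
elim: n => [|n [q hq qB]]; first by rewrite s0.
case: (hs n) => [->//|[d hd ->]]; exists ('X * q - d%:P).
  by rewrite rmorphB rmorphM /= map_polyX map_polyC /= !hornerE hq.
move=> z rz zb; have z1 := conj_lt1 rz zb.
rewrite rmorphB rmorphM /= map_polyX map_polyC /= !hornerE.
apply: le_trans (ler_normB _ _) _.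
apply: (@le_trans _ _ (`|z| * B z + K)); last first.
  rewrite /B le_eqVlt; apply/orP; left; apply/eqP; field.
  by rewrite subr_eq0 gt_eqF.
rewrite lerD //; first by rewrite normrM ler_wpM2l // qB.
rewrite -intr_norm /K (@le_trans _ _ D0%:R) //; last by rewrite lerDr.
by rewrite -[D0%:R]/(D0%:Z%:~R) ler_int.
Qed.

End finite_differences.

(** * Ergodicity of the beta map *)

(** For [x] in [[0, 1)], the right end of the image under [T^n] of the interval of points sharing
    the first [n] digits of [x]: stretched by [b], shifted by the digit, and cut at 1. *)
Fixpoint cylinder_top {R : realType} (b x : R) n : R :=
  if n is n'.+1 then
    Num.min 1 (b * cylinder_top b x n' - (Num.floor (b * iter n' (beta_map b) x))%:~R)
  else 1.

Section beta_ergodic.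
Context {R : realType} (b : R).
Hypothesis b1 : 1 < b.
Local Notation T := (beta_map b).
Local Notation lam := (@lebesgue_measure R).

Let b0 : 0 < b. Proof. exact: lt_trans b1. Qed.

Lemma beta_map_ge0_lt1 y : 0 <= T y < 1.
Proof.
by rewrite /beta_map subr_ge0 floor_le /= ltrBlDl -intrD1 floorD1_gt.
Qed.

Lemma iter_beta_map_ge0_lt1 x n : 0 <= x < 1 -> 0 <= iter n T x < 1.
Proof. by move=> x01; case: n => // n; exact: beta_map_ge0_lt1. Qed.

Lemma cylinder_top_gt x n : 0 <= x < 1 -> iter n T x < cylinder_top b x n <= 1.
Proof.
move=> x01; elim: n => [|n /andP[IH _]] /=; first by have /andP[_ ->] := x01; rewrite lexx.
have /andP[_ h] := beta_map_ge0_lt1 (iter n T x).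
by rewrite lt_min h ge_min lexx andbT /= /beta_map ltrD2r ltr_pM2l.
Qed.

(* [T^n] maps a segment around [x] of length at most [b^-n] affinely onto
   [[0, cylinder_top b x n)]. *)
Lemma cylinder_topP x n z : 0 <= x < 1 -> 0 <= z < cylinder_top b x n ->
  let w := x + (z - iter n T x) / b ^+ n in 0 <= w < 1 /\ iter n T w = z.
Proof.
move=> x01; elim: n z => [|n IH] z /=.
  by rewrite expr0 divr1 addrC subrK => z01.
set y := iter n T x; set d := (Num.floor (b * y))%:~R : R.
move=> /andP[z0]; rewrite lt_min => /andP[z1 zs].
have /andP[y0 _] : 0 <= y < 1 by exact: iter_beta_map_ge0_lt1.
have d0 : 0 <= d by rewrite ler0z floor_ge0 mulr_ge0 // ltW.
have [] := IH ((z + d) / b).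
  by rewrite divr_ge0 ?addr_ge0 ?(ltW b0) //= ltr_pdivrMr // -ltrBrDr mulrC.
have -> : x + ((z + d) / b - y) / b ^+ n = x + (z - T y) / b ^+ n.+1.
  rewrite /beta_map -/d exprS; congr (_ + _); field.
  by rewrite expf_neq0 gt_eqF.
move=> w01 ew; split => //=; rewrite ew /beta_map mulrC divfK ?gt_eqF //.
have -> : Num.floor (z + d) = Num.floor (b * y).
  apply: floor_def; rewrite intrD1 -/d lerDr z0 /= addrC ltrD2l; exact: z1.
by rewrite -/d addrK.
Qed.

(** Around a density point [x] of [E], the inverse branch of [T^n] carries [[0, dl)] into the ball
    of radius [b ^- n], shrinking measure by exactly [b ^+ n]. Invariance of [E] bounds the measure
    of [[0, dl)] outside [E] by [b ^+ n] times the part of the ball outside [E], and this tends to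
    0. *)
Lemma cylinder_density (E : set (measurableTypeR R)) (dl : R) : measurable E ->
  (forall y, unit_itv y -> E (T y) <-> E y) ->
  (forall x n, 0 <= x < 1 -> dl <= cylinder_top b x n) ->
  lam (E `&` unit_itv) <> 0%E -> lam (`[0%R, dl[%classic `\` E) = 0%E.
Proof.
move=> mE inv hdl posE.
have mnE : measurable (~` E) by exact: measurableC.
have mu : measurable (unit_itv : set (measurableTypeR R)) by exact: measurable_itv.
have [N [mN N0 sN]] := lebesgue_density mnE.
(* The point 1 is discarded with the null set [N], since cylinders are described for [x < 1]. *)
have [x [Ex x01 xN]] : exists x, [/\ E x, 0 <= x < 1 & ~ N x].
  apply: contrapT => no; apply: posE; apply/eqP; rewrite eq_le measure_ge0 andbT.
  have m1 : measurable [set (1 : R)] by exact: measurable_set1.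
  have NU1 : lam (N `|` [set 1]) = 0%E.
    by rewrite measureU0 //; exact: lebesgue_measure_set1.
  rewrite -[leRHS]NU1 le_measure ?inE //.
  - exact: measurableI.
  - exact: measurableU.
  - move=> y [Ey]; rewrite /unit_itv /= in_itv /= => /andP[y0 y1].
    have [y1'|y1'] := eqVneq y 1; [by right | left].
    by apply: contrapT => nN; apply: no; exists y; rewrite y0 lt_neqAle y1' y1.
have {xN sN} : (lam (~` E `&` ball x r) * (lam (ball x r))^-1)%E @[r --> 0^'+] --> 0%E.
  have -> : 0%E = (\1_(~` E) x)%:E :> \bar R by rewrite indicE memNset.
  by apply: contrapT => h; apply: xN; apply: sN.
move=> cv.
have unitw w : 0 <= w < 1 -> unit_itv w.
  by rewrite /unit_itv /= in_itv /= => /andP[-> /ltW].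
have invn n : forall w, 0 <= w < 1 -> E (iter n T w) <-> E w.
  elim: n => // n IH w w01; rewrite iterS -(IH w w01); apply: inv.
  by apply: unitw; exact: iter_beta_map_ge0_lt1.
set V := _ `\` E.
have mV : measurable V by apply: measurableD => //; exact: measurable_itv.
have bound n : (lam V <= (b ^+ n)%:E * lam (~` E `&` ball x (b ^- n)))%E.
  have bn : 0 < b ^+ n by rewrite exprn_gt0.
  have mB : measurable (~` E `&` ball x (b ^- n)).
    by apply: measurableI => //; exact: measurable_ball.
  set c := x - iter n T x / b ^+ n.
  have bn0 : b ^- n != 0 by rewrite invr_eq0 gt_eqF.
  have := lebesgue_measure_affine_preimage c bn0 mB.
  rewrite gtr0_norm ?invr_gt0 // invrK => <-.
  apply: le_measure; rewrite ?inE //.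
    exact: tame_preimage_measurable (tame_affine c bn0) mB.
  move=> z [/=]; rewrite in_itv /= => /andP[z0 zd] nEz.
  have zc : 0 <= z < cylinder_top b x n by rewrite z0 (lt_le_trans zd) // hdl.
  have := cylinder_topP x01 zc => /=; set w := x + _.
  have -> : b ^- n * z + c = w by rewrite /w /c; field; rewrite gt_eqF.
  move=> [w01 ew]; split; first by move=> /(invn n _ w01); rewrite ew.
  rewrite /ball /= /w opprD addNKr normrN normrM [X in _ * X]gtr0_norm ?invr_gt0 //.
  rewrite -[ltRHS]mul1r ltr_pM2r ?invr_gt0 //.
  have /andP[y0 y1] := iter_beta_map_ge0_lt1 n x01.
  have /andP[_ c1] := cylinder_top_gt n x01.
  by move/andP: zc => [_ zc]; rewrite ltr_norml; apply/andP; split; lra.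
apply/eqP; rewrite eq_le measure_ge0 andbT; apply/lee_addgt0Pr => e e0.
rewrite add0e.
(* The ball has measure [2 * b ^- n], so a density below [e / 2] gives exactly [e] after
   multiplication by [b ^+ n]. *)
have e20 : (0 < (e / 2)%:E :> \bar R)%E by rewrite lte_fin divr_gt0.
have : \forall r \near (0 : R)^'+,
    (lam (~` E `&` ball x r) * (lam (ball x r))^-1 < (e / 2)%:E)%E.
  by apply: (cv [set u : \bar R | (u < (e / 2)%:E)%E]); exact: open_ereal_lt'.
rewrite near_withinE => /nbhs_ballP[d /= d0 hd].
have [n nd] : exists n : nat, b ^- n < d.
  have /cvgrPdist_lt/(_ _ d0)[n _ /(_ n (leqnn n)) /= hn] :
      (fun n => b^-1 ^+ n) @ \oo --> (0 : R).
    by apply: cvg_expr; rewrite gtr0_norm ?invr_gt0 // invf_lt1.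
  by exists n; move: hn; rewrite sub0r normrN gtr0_norm ?exprVn // invr_gt0 exprn_gt0.
have bn : 0 < b ^- n by rewrite invr_gt0 exprn_gt0.
have := hd (b ^- n) _ bn; rewrite /ball /= sub0r normrN gtr0_norm // => /(_ nd).
rewrite lebesgue_measure_ball; last exact: ltW.
rewrite inver gt_eqF ?mulrn_wgt0 //.
rewrite lte_pdivrMr ?mulrn_wgt0 // -EFinM => hA.
apply: le_trans (bound n) _.
have bn' : 0 <= b ^+ n by rewrite exprn_ge0 // ltW.
apply: le_trans (lee_wpmul2l (_ : (0 <= (b ^+ n)%:E)%E) (ltW hA)) _; first by rewrite lee_fin.
rewrite -EFinM lee_fin le_eqVlt; apply/orP; left; apply/eqP.
by field; rewrite expf_neq0 // gt_eqF.
Qed.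

Lemma beta_map_ergodic (dl : R) (E : set (measurableTypeR R)) : 0 < dl ->
  (forall x n, 0 <= x < 1 -> dl <= cylinder_top b x n) ->
  measurable E -> (forall y, unit_itv y -> E (T y) <-> E y) ->
  lam (E `&` unit_itv) = 0%E \/ lam (unit_itv `\` E) = 0%E.
Proof.
move=> dl0 hdl mE inv.
have mu : measurable (unit_itv : set (measurableTypeR R)) by exact: measurable_itv.
case: (eqVneq (lam (E `&` unit_itv)) 0%E) => [|/eqP p1]; [by left | right].
apply: contrapT => p2.
have h1 := cylinder_density mE inv hdl p1.
have h2 : lam (`[0%R, dl[%classic `\` ~` E) = 0%E.
  apply: cylinder_density => //; first exact: measurableC.
    by move=> y yu; split => h /(inv _ yu).
  by rewrite setIC -setDE.
have mI : measurable (`[0%R, dl[%classic : set (measurableTypeR R)).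
  exact: measurable_itv.
rewrite setDE setCK in h2.
have : lam `[0%R, dl[%classic = (0 + 0)%E.
  by rewrite (measureDI lam mI mE); congr (_ + _)%E; [exact: h1 | exact: h2].
rewrite lebesgue_measure_itv /= lte_fin dl0 adde0 -EFinD subr0 => /eqP.
by rewrite eqe gt_eqF.
Qed.

End beta_ergodic.

(** * Coupling the orbits *)

Section orbit_sums.
Context {R : realType} (H : nat -> R) (M : nat -> nat) (c : nat).
Hypothesis H0 : forall n, 0 <= H n.
Hypothesis M0 : M 0%N = 0%N.
Hypothesis MS : forall k, (M k < M k.+1 <= M k + c)%N.

Let sum_mono n1 n2 : (n1 <= n2)%N -> \sum_(0 <= n < n1) H n <= \sum_(0 <= n < n2) H n.
Proof.
by move=> h; rewrite (big_cat_nat (leq0n _) h) /= lerDl sumr_ge0.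
Qed.

(** The times [M k] are distinct, and those with [k < N] are below [M N <= c * N]. *)
Lemma sum_subsequence N : \sum_(0 <= k < N) H (M k) <= \sum_(0 <= n < c * N) H n.
Proof.
apply: (@le_trans _ _ (\sum_(0 <= n < M N) H n)).
  elim: N => [|N IH]; first by rewrite M0 !big_geq.
  have /andP[h _] := MS N; rewrite big_nat_recr //=.
  by apply: le_trans (sum_mono h); rewrite big_nat_recr //= lerD2r.
apply: sum_mono; elim: N => [|N IH]; first by rewrite M0.
by have /andP[_ h] := MS N; apply: leq_trans h _; rewrite mulnS addnC leq_add2l.
Qed.

(** Gaps are at most [c], so the blocks of length [c] starting at the times [M k] cover everything;
    overlaps only increase the right side. *)
Lemma sum_le_blocks N :
  \sum_(0 <= n < N) H n <= \sum_(0 <= k < N) \sum_(j < c) H (M k + j)%N.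
Proof.
apply: (@le_trans _ _ (\sum_(0 <= n < M N) H n)).
  apply: sum_mono; elim: N => // N IH.
  by have /andP[h _] := MS N; apply: leq_ltn_trans IH h.
elim: N => [|N IH]; first by rewrite M0 !big_geq.
have /andP[h1 h2] := MS N; rewrite [leRHS]big_nat_recr //=.
rewrite (big_cat_nat (leq0n _) (ltnW h1)) /= lerD //.
rewrite -(big_mkord xpredT (fun j => H (M N + j)%N)).
apply: (@le_trans _ _ (\sum_(M N <= n < M N + c) H n)).
  by rewrite [leRHS](big_cat_nat (ltnW h1) h2) /= lerDl sumr_ge0.
rewrite -{1}[M N]add0n big_addn addKn.
by apply: ler_sum => j _; rewrite addnC.
Qed.

End orbit_sums.

Lemma positive_lower_bound (R : realType) (F : seq R) :
  exists2 dl : R, 0 < dl & forall w, w \in F -> 0 < w -> dl <= w.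
Proof.
elim: F => [|w F [dl dl0 h]]; first by exists 1.
case: (ltP 0 w) => w0.
  exists (Num.min dl w); first by rewrite lt_min dl0.
  move=> v; rewrite inE ge_min => /predU1P[->|vF] v0; first by rewrite lexx orbT.
  by rewrite h.
exists dl => // v; rewrite inE => /predU1P[->|]; last exact: h.
by rewrite ltNge w0.
Qed.

(** * The beta map under the Pisot hypothesis, and its coupling with [S] *)

Section beta_map.
Context {R : realType} (b : R) (p : {poly int}).
Hypothesis b1 : 1 < b.
Hypothesis mp : p \is monic.
Hypothesis irr : irreducible_poly (map_poly (intr : int -> rat) p).
Hypothesis rb : root (map_poly intr p) b.
Hypothesis conj_lt1 : forall z : R[i], root (map_poly intr p) z ->
  z != (b%:C)%C -> `|z| < 1.
Local Notation T := (beta_map b).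

Lemma tame_beta_map : tame (unit_ext T).
Proof.
have b0 : 0 < b := lt_trans ltr01 b1.
apply: (@tame_piecewise R T int
  (fun d => [set y | unit_itv y /\ Num.floor (b * y) = d]) (fun=> b) (fun d => - d%:~R)).
- move=> d x y z [xu xd] [zu zd] /andP[xy yz]; split.
    move: xu zu; rewrite /unit_itv /= !in_itv /= => /andP[x0 _] /andP[_ z1].
    by rewrite (le_trans x0 xy) (le_trans yz z1).
  by apply: le_anti; rewrite -{1}zd -xd !le_floor // ler_wpM2l // ltW.
- by move=> d y [].
- by move=> y yu; exists (Num.floor (b * y)).
- by move=> _; rewrite gt_eqF.
- by move=> d y [yu <-].
Qed.

Lemma cylinder_top_lower_bound : exists2 dl : R, 0 < dl &
  forall x n, 0 <= x < 1 -> dl <= cylinder_top b x n.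
Proof.
have [F hF] := beta_remainders_finite mp irr rb conj_lt1.
have [dl dl0 h] := positive_lower_bound F; exists dl => // x n x01.
have top01 k : 0 < cylinder_top b x k <= 1.
  have /andP[y0 _] := iter_beta_map_ge0_lt1 b k x01.
  by have /andP[h1 ->] := cylinder_top_gt b1 k x01; rewrite (le_lt_trans y0).
apply: h; last by have /andP[] := top01 n.
apply: hF => // [k|k]; first by have /andP[/ltW -> ->] := top01 k.
rewrite [cylinder_top b x k.+1]/=.
have [h1|h1] := leP; first by left.
right; exists (Num.floor (b * iter k T x)) => //; apply: (digit_bound b1).
have /andP[y0 y1] := iter_beta_map_ge0_lt1 b k x01.
by rewrite /unit_itv /= in_itv /= y0 ltW.
Qed.

(** The time [M k] adds up the exponents of the pieces visited by [S], so that both orbits have been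
    expanded by the same power of [b], and [s k] is the product of the signs met. The list [F] and
    the gap bound [c] do not depend on [x]. *)
Lemma orbit_coupling (l : nat) (J : 'I_l -> interval R) (eps bb : 'I_l -> R)
    (m : 'I_l -> nat) (S : R -> R) :
  (forall y, unit_itv y -> exists i, y \in J i) ->
  (forall i, eps i = 1 \/ eps i = -1) -> (forall i, (0 < m i)%N) ->
  (forall i, in_Qbeta b (bb i)) ->
  (forall y, unit_itv y -> unit_itv (S y)) ->
  (forall i y, unit_itv y -> y \in J i -> S y = eps i * b ^+ m i * y + bb i) ->
  exists (F : seq R) (c : nat), forall x, unit_itv x ->
    exists (M : nat -> nat) (s : nat -> R), [/\ M 0%N = 0%N,
      forall k, (M k < M k.+1 <= M k + c)%N,
      forall k, s k = 1 \/ s k = -1 &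
      forall k, iter k S x - s k * iter (M k) T x \in F].
Proof.
move=> Jcov heps m0 hbb Su SJ.
have [F hF] := skew_differences_finite b1 mp irr rb conj_lt1 heps hbb m0.
exists F, (\max_i m i) => x xu.
have /choice[idx hidx] : forall k, exists i, iter k S x \in J i.
  by move=> k; apply: Jcov; elim: k => //= k; exact: Su.
have Sku k : unit_itv (iter k S x) by elim: k => //= k; exact: Su.
pose M k := (\sum_(0 <= j < k) m (idx j))%N.
pose s k := \prod_(0 <= j < k) eps (idx j).
have MS k : M k.+1 = (M k + m (idx k))%N by rewrite /M big_nat_recr.
have sS k : s k.+1 = eps (idx k) * s k by rewrite /s big_nat_recr //= mulrC.
exists M, s; split.
- by rewrite /M big_geq.
- by move=> k; rewrite MS -addn1 !leq_add2l m0 leq_bigmax.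
- elim=> [|k IH]; first by left; rewrite /s big_geq.
  rewrite sS; case: (heps (idx k)) => ->; case: IH => ->;
    rewrite ?mul1r ?mulN1r ?opprK; tauto.
- apply: (hF idx (fun k => iter k S x) (fun k => iter (M k) T x) s) => //.
  + by rewrite /M big_geq.
  + by rewrite /s big_geq.
  + by move=> k; case: (M k) => // n; exact: beta_map_unit.
  + by move=> k; rewrite [LHS]/=; exact: SJ.
  + by move=> k; rewrite MS addnC iterD.
Qed.

End beta_map.

Unset Implicit Arguments.

Theorem theorem3p3 (R : realType) (beta : R)
  (mu : {measure set (measurableTypeR R) -> \bar R})
  (l : nat) (J : 'I_l -> interval R)
  (eps : 'I_l -> R) (m : 'I_l -> nat) (b : 'I_l -> R)
  (S : R -> R) (nu : {measure set (measurableTypeR R) -> \bar R}) (c : R) :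
  pisot beta ->
  (* mu is the (unique) absolutely continuous invariant probability of T *)
  prob_on_unit mu -> abs_cont_leb mu -> preserves (beta_map beta) mu ->
  (* finite partition of [0,1] into subintervals *)
  (forall i x, x \in J i -> 0 <= x <= 1) ->
  (forall x, 0 <= x <= 1 -> exists! i, x \in J i) ->
  (forall i, eps i = 1 \/ eps i = -1) ->
  (forall i, (0 < m i)%N) ->
  (forall i, in_Qbeta beta (b i)) ->
  (forall x, 0 <= x <= 1 -> 0 <= S x <= 1) ->
  (forall i x, 0 <= x <= 1 -> x \in J i ->
     S x = eps i * beta ^+ m i * x + b i) ->
  prob_on_unit nu -> preserves S nu -> ergodic S nu -> abs_cont_leb nu ->
  0 < c ->
  (forall E : set (measurableTypeR R), measurable E -> E `<=` unit_itv ->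
     ((c^-1)%:E * lebesgue_measure E <= nu E)%E /\
     (nu E <= c%:E * lebesgue_measure E)%E) ->
  forall x, 0 <= x <= 1 ->
    (generic (beta_map beta) mu x <-> generic S nu x).
Proof.
move=> [beta1 [p [mp irr rb conj]]] pmu acmu invmu Ju Jcov heps m0 hb Su SJ.
move=> pnu invnu ergnu acnu c0 hc x x01.
have u01 y : unit_itv y <-> 0 <= y <= 1 by rewrite /unit_itv /= in_itv.
have xu : unit_itv x by apply/u01.
have Su' y : unit_itv y -> unit_itv (S y) by move=> /u01 yu; apply/u01; exact: Su.
have Tu' y : unit_itv y -> unit_itv (beta_map beta y) by move=> _; exact: beta_map_unit.
have Jcov' y : unit_itv y -> exists i, y \in J i.
  by move=> /u01 /Jcov [i [yi _]]; exists i.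
have SJ' i y : unit_itv y -> y \in J i -> S y = eps i * beta ^+ m i * y + b i.
  by move=> /u01; exact: SJ.
have eps0 i : eps i != 0 by case: (heps i) => ->; rewrite ?oppr_eq0 oner_neq0.
have beta0 : 0 < beta := lt_trans ltr01 beta1.
have tT := tame_beta_map beta1.
have tS : tame (unit_ext S).
  apply: (@tame_piecewise R S 'I_l (fun i => [set` J i])
    (fun i => eps i * beta ^+ m i) b).
  - move=> i y z t yJ tJ yzt; exact: (@interval_is_interval _ (J i) y t yJ tJ).
  - by move=> i y yJ; apply/u01; exact: Ju yJ.
  - exact: Jcov'.
  - by move=> i; rewrite mulf_neq0 // expf_neq0 // gt_eqF.
  - by move=> i y yJ; apply: SJ' => //; apply/u01; exact: Ju yJ.
have mu01 : measurable (unit_itv : set (measurableTypeR R)) by exact: measurable_itv.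
have [dl dl0 hdl] := cylinder_top_lower_bound beta1 mp irr rb conj.
have trivT (E : set (measurableTypeR R)) : measurable E -> E `<=` unit_itv ->
    unit_ext (beta_map beta) @^-1` E = E ->
    lebesgue_measure E = 0%E \/ mu (~` E) = 0%E.
  move=> mE Eu EE.
  have Einv y : unit_itv y -> E (beta_map beta y) <-> E y.
    by move=> yu; rewrite -{2}EE /preimage /= unit_ext_in.
  case: (beta_map_ergodic beta1 dl0 hdl mE Einv); first by rewrite setIidl //; left.
  move=> h; right; rewrite (prob_on_unitI pmu (measurableC mE)) setIC -setDE.
  by apply: acmu => //; exact: measurableD.
have trivS (E : set (measurableTypeR R)) : measurable E -> E `<=` unit_itv ->
    unit_ext S @^-1` E = E -> lebesgue_measure E = 0%E \/ nu (~` E) = 0%E.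
  move=> mE Eu EE.
  have EI : unit_itv `&` S @^-1` E = E.
    apply/seteqP; split => y.
      by move=> [yu Sy]; rewrite -EE /preimage /= unit_ext_in.
    by move=> Ey; have yu := Eu _ Ey; split => //; rewrite -EE /preimage /= unit_ext_in in Ey.
  case: (ergnu E mE Eu EI) => h; [left | right].
    (* The lower comparison of [nu] with Lebesgue measure turns a [nu]-null set into a Lebesgue-null
       one. *)
    have [h1 _] := hc E mE Eu; rewrite h in h1.
    apply/eqP; rewrite eq_le measure_ge0 andbT.
    by move: h1; rewrite lee_pdivrMl // mule0.
  have : nu setT = (nu E + nu (~` E))%E.
    by rewrite -(setUv E); apply: measureU; rewrite ?setICr //; exact: measurableC.
  rewrite (prob_on_unit_setT pnu) h.
  by case: (nu (~` E)) => [r||] //= [e]; congr EFin; lra.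
have ergoT := @birkhoff R mu _ (prob_on_unit_setT pmu) (tame_measurable tT)
  (fun y => unit_ext_unit y Tu') (unit_ext_invariant Tu' tT pmu invmu) trivT.
have ergoS := @birkhoff R nu _ (prob_on_unit_setT pnu) (tame_measurable tS)
  (fun y => unit_ext_unit y Su') (unit_ext_invariant Su' tS pnu invnu) trivS.
have [F [C /(_ x xu)[M [s [M0 MS s1 hF]]]]] :=
  orbit_coupling beta1 mp irr rb conj Jcov' heps m0 hb Su' SJ'.
have C0 : (0 < C)%N by have := MS 0%N; rewrite M0; lia.
pose sg (t : bool) : R := if t then 1 else -1.
have sg0 t : sg t != 0 by case: t; rewrite /sg ?oppr_eq0 oner_neq0.
have sgs k : exists t, s k = sg t by case: (s1 k) => ->; [exists true | exists false].
pose j k := Ordinal (etrans (index_mem _ F) (hF k) : index _ F < size F)%N.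
have jE k : F`_(j k) = iter k S x - s k * iter (M k) (beta_map beta) x.
  by rewrite nth_index.
split => [genT|genS].
- rewrite -(generic_unit_ext nu Su' xu).
  (* Each [S^k x] is the image of [T^(M k) x] under one of these maps, selected by a difference in
     [F] and a sign. *)
  pose a (i : 'I_(size F) * bool) y := sg i.2 * y + F`_i.1.
  apply: (generic_criterion pnu tS (fun y => unit_ext_unit y Su') ergoS pmu acmu
    genT xu C0 (a := a)).
    by move=> i; exact: tame_affine.
  move=> g g0 _ N.
  pose H n := \sum_i g (a i (iter n (beta_map beta) x)).
  apply: le_trans (sum_subsequence (H := H) _ M0 MS N); last first.
    by move=> n; exact: sumr_ge0.
  apply: ler_sum => k _; have [-> _] := iter_unit_ext k Su' xu.
  have [t st] := sgs k; rewrite /H (bigD1 (j k, t)) //=.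
  by rewrite /a /= jE st [sg t * _ + _]addrC subrK lerDl sumr_ge0.
- rewrite -(generic_unit_ext mu Tu' xu).
  (* As signs square to 1, the affine factor recovers [T^(M k) x] from [S^k x]; the iterates of
     index below [C] then fill the gap up to the next time [M k.+1]. *)
  pose a (i : 'I_C * ('I_(size F) * bool)) :=
    iter i.1 (unit_ext (beta_map beta)) \o (fun y => sg i.2.2 * y + - sg i.2.2 * F`_i.2.1).
  apply: (generic_criterion pmu tT (fun y => unit_ext_unit y Tu') ergoT pnu acnu
    genS xu (ltn0Sn 0) (a := a)).
    by move=> i; apply: tame_comp; [exact: tame_iter | exact: tame_affine].
  move=> g g0 _ N; rewrite mul1n.
  pose H n := g (iter n (unit_ext (beta_map beta)) x).
  apply: (le_trans (sum_le_blocks (H := H) _ M0 MS N)); first by move=> n; exact: g0.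
  apply: ler_sum => k _; have [t st] := sgs k.
  have -> : \sum_i g (a i (iter k S x)) =
      \sum_(i < C) \sum_i2 g (a (i, i2) (iter k S x)).
    by rewrite pair_bigA; apply: eq_bigr => -[].
  apply: ler_sum => i _; rewrite (bigD1 (j k, t)) //= /a /= jE.
  have [e1 _] := iter_unit_ext (M k) Tu' xu.
  have -> : sg t * iter k S x +
      - sg t * (iter k S x - s k * iter (M k) (beta_map beta) x) =
      iter (M k) (beta_map beta) x.
    by rewrite st /sg; case: (t); ring.
  by rewrite /H addnC iterD e1 lerDl; exact: sumr_ge0.
Qed.
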